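(* Let $(\bar u,\bar w)\in K$ be a local solution of $$\min_{(u,w)\in K}\; \Phi_0(u,w):=f(u)+\frac{\alpha}{2}\|u\|_U^2+\frac{\beta}{2}\|w\|_W^2+\gamma\int_\Omega |w|^p\,dx .$$ Then there are $\bar\lambda\in W^*$ and $\bar\mu^1,\bar\mu^2\in U$ such that $$f'(\bar u)v+\alpha(\bar u,v)_U+\beta(\bar w,z)_W+\gamma\langle\bar\lambda,z\rangle_W+(\bar\mu^1,z-v)_U+(\bar\mu^2,z+v)_U=0\quad\forall (v,z)\in U\times W,$$ and $$\langle\bar\lambda,\bar w\rangle_W=p\int_\Omega|\bar w|^p\,dx .$$ Moreover, $\bar\mu^1\in\partial I_C(\bar w-\bar u)$ and $\bar\mu^2\in\partial I_C(\bar w+\bar u)$.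
   Context: Setting. $\Omega\subset\mathbb{R}^d$ is a bounded Lipschitz domain, $I=(0,T)$ with $T>0$, and $U:=L^2(I\times\Omega)$, identified with its dual. All functions are real valued. A function $w$ on $\Omega$ is extended to $I\times\Omega$ by $w(t,x):=w(x)$ when needed; e.g. $(\mu,z-v)_U=\int_\Omega\int_I\mu(t,x)(z(x)-v(t,x))\,dt\,dx$. The space $W$ is one of the Hilbert spaces $H^s(\Omega)$, $H^s_0(\Omega)$, $\tilde H^s(\Omega)$, $\mathbb{H}^s(\Omega)$ for some $s\in(0,1)$, where: (1) $H^s(\Omega)$ is the set of $w\in L^2(\Omega)$ with $\int_\Omega\int_\Omega \frac{|w(x)-w(y)|^2}{|x-y|^{d+2s}}\,dy\,dx<\infty$, with inner product $(u,w)_{H^s(\Omega)}=\int_\Omega uw\,dx+\frac{c_{d,s}}{2}\int_\Omega\int_\Omega\frac{(u(x)-u(y))(w(x)-w(y))}{|x-y|^{d+2s}}\,dy\,dx$, $c_{d,s}=\frac{s2^{2s}\Gamma(s+d/2)}{\pi^{d/2}\Gamma(1-s)}$; (2) $H^s_0(\Omega)$ is the closure of $C_c^\infty(\Omega)$ in $H^s(\Omega)$, with the $H^s(\Omega)$-inner product; (3) $\tilde H^s(\Omega)=\{w\in H^s(\mathbb{R}^d): w=0 \text{ on } \mathbb{R}^d\setminus\Omega\}$, with the $H^s(\mathbb{R}^d)$-inner product (same formula as in (1) with $\mathbb{R}^d$ in place of $\Omega$); (4) $\mathbb{H}^s(\Omega)=\{w=\sum_n w_n\phi_n\in L^2(\Omega):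 \|w\|^2_{\mathbb{H}^s}=\sum_n\lambda_n^s w_n^2<\infty\}$, where $w_n=\int_\Omega w\phi_n\,dx$ and $(\phi_n,\lambda_n)$ are the ($L^2$-orthonormal) eigenfunctions and eigenvalues of the Laplacian with zero Dirichlet boundary conditions, with inner product $\sum_n\lambda_n^s u_nw_n$. $\langle\cdot,\cdot\rangle_W$ is the duality pairing of $W^*$ and $W$. The admissible set is $K:=\{(u,w)\in U\times W: |u(t,x)|\le w(x) \text{ for a.a. } (t,x)\in I\times\Omega\}$. A local solution is a pair $(\bar u,\bar w)\in K$ for which there is $\rho>0$ with $\Phi_0(\bar u,\bar w)\le\Phi_0(u,w)$ for all $(u,w)\in K$ with $\|u-\bar u\|_U\le\rho$, $\|w-\bar w\|_W\le\rho$. $C:=\{v\in U: v\ge0\}$ and $I_C$ is its indicator function ($0$ on $C$, $+\infty$ otherwise). For $\bar v\in C$, $\mu\in U$ belongs to the convex subdifferential $\partial I_C(\bar v)$ iff $(\mu,v-\bar v)_U\le0$ for all $v\in C$. Standing assumptions. $f:U\to\mathbb{R}$ is weakly lower semicontinuous, bounded from below by an affine function (there are $g\in U^*$, $c\in\mathbb{R}$ with $f(u)\ge g(u)+c$ for all $u\in U$), and continuously Fréchet differentiable. $\alpha,\beta,\gamma>0$ and $p\in(0,1)$. *)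

(* Defs.v *)
From HB Require Import structures.
From mathcomp Require Import all_boot all_order all_algebra.
From mathcomp Require Import all_classical all_reals all_analysis.
From mathcomp Require Import measurable_realfun ess_sup_inf generic_quotient.
Set Implicit Arguments.
Unset Strict Implicit.
Unset Printing Implicit Defensive.
Import Order.TTheory GRing.Theory Num.Theory.
Import numFieldNormedType.Exports.
Local Open Scope classical_set_scope.
Local Open Scope ring_scope.

(* Vector operations and norm on the library's L^p spaces of a.e. classes. *)
Section Lspace_normedModType.
Local Open Scope quotient_scope.
Context d (T : measurableType d) (R : realType).
Variables (mu : {measure set T -> \bar R}) (p : \bar R) (p1 : (1 <= p)%E).

Notation Lp := (LspaceType mu p1).
Notation Lf := (LfunType mu p1).

Lemma ae_eq_Lnorm (f g : T -> R) :
  measurable_fun setT f -> measurable_fun setT g ->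
  f = g %[ae mu] -> ('N[mu]_p[EFin \o f] = 'N[mu]_p[EFin \o g])%E.
Proof.
move=> mf mg fg; rewrite Lnorm.unlock; case: p p1 => [r _|_|_].
- have mp (h : T -> R) : measurable_fun setT h ->
      measurable_fun setT (fun x => (`|(h x)%:E| `^ r)%E).
    move=> mh; apply/measurable_EFinP.
    by apply: (measurableT_comp (measurable_powR _)); exact: measurableT_comp.
  apply: (congr1 (fun z => z `^ r^-1)%E); apply: ge0_ae_eq_integral.
  + exact: measurableT.
  + exact: mp.
  + exact: mp.
  + by move=> x _; exact: poweR_ge0.
  + by move=> x _; exact: poweR_ge0.
  + by apply: filterS fg => x /= /(_ I) ->.
- case: ifP => _; last by [].
  by apply: eq_ess_sup; apply: filterS fg => x /= /(_ I) ->.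
- case: ifP => _; last by [].
  by apply: eq_ess_inf; apply: filterS fg => x /= /(_ I) ->.
Qed.

Lemma Lspace_eqP (f g : Lp) : f = g <-> f = g %[ae mu].
Proof.
split=> [->|]; first exact: ae_eq_refl.
case: f g => [f [[hf]]] [g [[hg]]] /= fg.
have {}fg : f = g.
  by move/(introT (ae_eqP _ _)): fg; rewrite !reprK => /eqP.
case: _ / fg in hg *.
by rewrite (bool_irrelevance hf hg).
Qed.

Lemma aeEqMfun_measurable (f : {mfun_ mu, T >-> measurableTypeR R}) :
  measurable_fun setT (f : T -> R).
Proof. exact: (@measurable_funPT _ _ _ _ (repr f)). Qed.

Lemma Lspace_measurable (f : Lp) : measurable_fun setT (f : T -> R).
Proof. exact: aeEqMfun_measurable. Qed.

Lemma Lspace_Lfun (f : Lp) : (f : T -> R) \in Lfun mu p.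
Proof.
apply/andP; split; rewrite inE/=; first exact: Lspace_measurable.
by case: f => f [[]].
Qed.

Definition toLfun (f : Lp) : Lf := Lfun_Sub p1 (Lspace_Lfun f).

Let mfunR (f : Lf) : {mfun T >-> measurableTypeR R} :=
  HB.pack_for {mfun T >-> measurableTypeR R} (f : T -> R)
    (@isMeasurableFun.Build _ _ T (measurableTypeR R) f (measurable_funPT f)).

Definition Lclass_mfun (f : Lf) : {mfun_ mu, T >-> measurableTypeR R} :=
  \pi_({mfun_ mu, T >-> measurableTypeR R}) (mfunR f).

Lemma Lclass_mfunE (f : Lf) : Lclass_mfun f = f %[ae mu].
Proof. by have /eqmodP/asboolP := reprK (Lclass_mfun f). Qed.

Lemma Lclass_finite (f : Lf) : finite_norm mu p (Lclass_mfun f).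
Proof.
rewrite /finite_norm (ae_eq_Lnorm _ _ (Lclass_mfunE f)); last 2 first.
- exact: aeEqMfun_measurable.
- exact: measurable_funPT.
exact: Lfunction_finite.
Qed.

HB.instance Definition _ (f : Lf) :=
  @isFinLebesgue.Build d T R mu p p1 (Lclass_mfun f) (Lclass_finite f).

Definition Lclass (f : Lf) : Lp := Lclass_mfun f.

Lemma LclassE (f : Lf) : Lclass f = f %[ae mu].
Proof. exact: Lclass_mfunE. Qed.

HB.instance Definition _ := gen_eqMixin Lp.
HB.instance Definition _ := gen_choiceMixin Lp.

Let Ladd (f g : Lp) := Lclass (toLfun f + toLfun g).
Let Lopp (f : Lp) := Lclass (- toLfun f).
Let Lscale (a : R) (f : Lp) := Lclass (a *: toLfun f).
Let L0 : Lp := Lclass 0.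

Let LaddE (f g : Lp) : \forall x \ae mu, Ladd f g x = f x + g x.
Proof. by apply: filterS (LclassE (toLfun f + toLfun g)) => x /(_ I). Qed.
Let LoppE (f : Lp) : \forall x \ae mu, Lopp f x = - f x.
Proof. by apply: filterS (LclassE (- toLfun f)) => x /(_ I). Qed.
Let LscaleE a (f : Lp) : \forall x \ae mu, Lscale a f x = a * f x.
Proof. by apply: filterS (LclassE (a *: toLfun f)) => x /(_ I). Qed.
Let L0E : \forall x \ae mu, L0 x = 0.
Proof. by apply: filterS (LclassE 0) => x /(_ I). Qed.

Let LaddA : associative Ladd.
Proof.
move=> f g h; apply/Lspace_eqP.
near=> x => _.
rewrite (near (LaddE f (Ladd g h)) x)// (near (LaddE g h) x)//.
rewrite (near (LaddE (Ladd f g) h) x)// (near (LaddE f g) x)//.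
by rewrite addrA.
Unshelve. all: by end_near. Qed.

Let LaddC : commutative Ladd.
Proof.
move=> f g; apply/Lspace_eqP; near=> x => _.
by rewrite (near (LaddE f g) x)// (near (LaddE g f) x)// addrC.
Unshelve. all: by end_near. Qed.

Let Ladd0 : left_id L0 Ladd.
Proof.
move=> f; apply/Lspace_eqP; near=> x => _.
by rewrite (near (LaddE L0 f) x)// (near L0E x)// add0r.
Unshelve. all: by end_near. Qed.

Let LaddN : left_inverse L0 Lopp Ladd.
Proof.
move=> f; apply/Lspace_eqP; near=> x => _.
rewrite (near (LaddE (Lopp f) f) x)// (near L0E x)// (near (LoppE f) x)//.
by rewrite addNr.
Unshelve. all: by end_near. Qed.

HB.instance Definition _ := GRing.isZmodule.Build Lp LaddA LaddC Ladd0 LaddN.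

Lemma LspaceD (f g : Lp) : \forall x \ae mu, (f + g) x = f x + g x.
Proof. exact: LaddE. Qed.

Let LscaleA a b (f : Lp) : Lscale a (Lscale b f) = Lscale (a * b) f.
Proof.
apply/Lspace_eqP; near=> x => _.
rewrite (near (LscaleE a (Lscale b f)) x)// (near (LscaleE b f) x)//.
by rewrite (near (LscaleE (a * b) f) x)// mulrA.
Unshelve. all: by end_near. Qed.

Let Lscale1 : left_id 1 Lscale.
Proof.
move=> f; apply/Lspace_eqP; near=> x => _.
by rewrite (near (LscaleE 1 f) x)// mul1r.
Unshelve. all: by end_near. Qed.

Let LscaleDr : right_distributive Lscale +%R.
Proof.
move=> a f g; apply/Lspace_eqP; near=> x => _.
rewrite (near (LscaleE a (f + g)) x)// (near (LspaceD f g) x)//.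
rewrite (near (LspaceD (Lscale a f) (Lscale a g)) x)//.
by rewrite (near (LscaleE a f) x)// (near (LscaleE a g) x)// mulrDr.
Unshelve. all: by end_near. Qed.

Let LscaleDl (f : Lp) : {morph Lscale^~ f : a b / a + b}.
Proof.
move=> a b; apply/Lspace_eqP; near=> x => _.
rewrite (near (LscaleE (a + b) f) x)//.
rewrite (near (LspaceD (Lscale a f) (Lscale b f)) x)//.
by rewrite (near (LscaleE a f) x)// (near (LscaleE b f) x)// mulrDl.
Unshelve. all: by end_near. Qed.

HB.instance Definition _ := GRing.Zmodule_isLmodule.Build R Lp
  LscaleA Lscale1 LscaleDr LscaleDl.

Lemma LspaceZ a (f : Lp) : \forall x \ae mu, (a *: f) x = a * f x.
Proof. exact: LscaleE. Qed.

Let Lnm (f : Lp) : R := fine ('N[mu]_p[EFin \o f])%E.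

Let LnmD (f g : Lp) : Lnm (f + g) <= Lnm f + Lnm g.
Proof.
rewrite /Lnm (@ae_eq_Lnorm _ (toLfun f + toLfun g) _ _ (LclassE _)).
exact: (ler_LnormD (toLfun f) (toLfun g)).
exact: Lspace_measurable.
exact: measurable_funPT.
Qed.

Let LnmZ a (f : Lp) : Lnm (a *: f) = `|a| * Lnm f.
Proof.
rewrite /Lnm (@ae_eq_Lnorm _ (a *: toLfun f) _ _ (LclassE _)).
have := LnormZ (toLfun f) a.
move/(congr1 fine); rewrite fineM//.
by have := finite_norm_fine (toLfun f); rewrite /= => <-.
exact: Lspace_measurable.
exact: measurable_funPT.
Qed.

Let Lnm0_eq0 (f : Lp) : Lnm f = 0 -> f = 0.
Proof.
move=> /(@fine_Lnormr_eq0 _ _ _ _ _ p1 (toLfun f)) f0; apply/Lspace_eqP.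
near=> x => _.
have -> : (f : T -> R) x = 0 by have := near f0 x; apply.
by rewrite (near L0E x).
Unshelve. all: by end_near. Qed.

HB.instance Definition _ := Lmodule_isNormed.Build R Lp LnmD LnmZ Lnm0_eq0.

Lemma Lspace_normE (f : Lp) : `|f| = fine ('N[mu]_p[EFin \o f])%E.
Proof. by []. Qed.

End Lspace_normedModType.

Definition rV_display : measure_display.
Proof. by constructor. Qed.

(* The Borel sigma-algebra of R^n, generated by the coordinates. *)
Section rV_measurable.
Context (R : realType) (n : nat).

Let coord (i : 'I_n) (x : 'rV[R]_n) : measurableTypeR R := x 0 i.

Let rV_set0 : g_sigma_preimage coord set0.
Proof. exact: sigma_algebra0. Qed.

Let rV_setC A : g_sigma_preimage coord A -> g_sigma_preimage coord (~` A).
Proof. exact: sigma_algebraC. Qed.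

Let rV_bigcup (F : _^nat) : (forall i, g_sigma_preimage coord (F i)) ->
  g_sigma_preimage coord (\bigcup_i (F i)).
Proof. exact: sigma_algebra_bigcup. Qed.

HB.instance Definition _ := @isMeasurable.Build rV_display
  'rV[R]_n (g_sigma_preimage coord) rV_set0 rV_setC rV_bigcup.

Lemma measurable_coord (i : 'I_n) :
  measurable_fun [set: 'rV[R]_n] (fun x => x 0 i).
Proof.
move=> _ Y mY; rewrite setTI; apply: sub_sigma_algebra => /=.
rewrite -bigcup_seq/=; exists i => /=; first by rewrite mem_index_enum.
by exists Y => //; rewrite setTI.
Qed.

Lemma measurable_rVP d (T : measurableType d) (f : T -> 'rV[R]_n) :
  (forall i, measurable_fun [set: T] (fun t => f t 0 i)) ->
  measurable_fun [set: T] f.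
Proof.
move=> mf.
suff : g_sigma_preimage (fun i => coord i \o f) `<=` @measurable _ T.
  rewrite g_sigma_preimage_comp => preS _ A mA.
  by apply: preS; exists A.
apply: smallest_sub; first exact: sigma_algebra_measurable.
move=> A; rewrite -bigcup_seq => -[i _ [B mB <-]].
exact: (mf i measurableT B mB).
Qed.

Lemma open_measurable_rV (A : set 'rV[R]_n) : open A -> measurable A.
Proof.
move=> oA.
pose q2r (q : 'rV[rat]_n) : 'rV[R]_n := map_mx (@ratr R) q.
pose B (qk : 'rV[rat]_n * nat) : set 'rV[R]_n :=
  \bigcap_(i : 'I_n) [set x | `|q2r qk.1 0 i - x 0 i| < qk.2.+1%:R^-1].
have mB qk : measurable (B qk).
  rewrite /B; apply: fin_bigcap_measurable => [|i _]; first exact: finite_finset.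
  have := @measurable_coord i measurableT _
    (measurable_ball (q2r qk.1 0 i) qk.2.+1%:R^-1).
  by rewrite setTI.
have BP qk x : B qk x <-> forall i, `|q2r qk.1 0 i - x 0 i| < qk.2.+1%:R^-1.
  by split=> [h i|h i _]; [exact: (h i I)|exact: h].
have -> : A = \bigcup_(qk in [set qk | B qk `<=` A]) B qk.
  apply/seteqP; split => [x Ax|x [qk /= BA]]; last exact: BA.
  have /nbhs_ballP[e /= e0 xeA] : nbhs x A by exact: open_nbhs_nbhs.
  have [k ke] : exists k : nat, k.+1%:R^-1 < e / 2.
    have := @near_infty_natSinv_lt R (PosNum (divr_gt0 e0 (ltr0n R 2))).
    by case=> k _ /(_ k (leqnn k)); exists k.
  have k0 : 0 < k.+1%:R^-1 :> R by rewrite invr_gt0 ltr0n.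
  have /= rx (i : 'I_n) : {r : rat | `|ratr r - x 0 i| < k.+1%:R^-1}.
    apply: cid.
    have : x 0 i - k.+1%:R^-1 < x 0 i + k.+1%:R^-1.
      by rewrite ltrBlDr -addrA ltrDl addr_gt0.
    move=> /rat_in_itvoo[r]; rewrite in_itv/= => /andP[r1 r2]; exists r.
    by rewrite distrC ltr_distlC r1 r2.
  pose q : 'rV[rat]_n := \row_i sval (rx i).
  exists (q, k); last first.
    by apply/BP => i /=; rewrite !mxE; exact: (svalP (rx i)).
  move=> y /BP/= qy; apply: xeA; split => // j i.
  rewrite /ball/= !ord1.
  rewrite (splitr e) -(subrKA (q2r q 0 i)).
  apply: (le_lt_trans (ler_normD _ _)); apply: ltrD.
    rewrite distrC; apply: lt_trans ke.
    by rewrite /q2r !mxE; exact: (svalP (rx i)).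
  exact: lt_trans ke.
rewrite bigcup_mkcond; apply: countable_bigcupT_measurable => [|qk].
  exact: countableP.
by case: ifP.
Qed.

End rV_measurable.

Section lebesgue_rV.
Context (R : realType).

Definition rV_cons n (x : measurableTypeR R * 'rV[R]_n) : 'rV[R]_n.+1 :=
  row_mx (const_mx x.1 : 'rV[R]_1) x.2.

Definition rV_uncons n (v : 'rV[R]_n.+1) : measurableTypeR R * 'rV[R]_n :=
  (v 0 0, rsubmx (v : 'rV[R]_(1 + n))).

Lemma rV_consK n : cancel (@rV_cons n) (@rV_uncons n).
Proof.
move=> [x v]; rewrite /rV_uncons /rV_cons row_mxKr; congr pair => /=.
have e : lshift n (0 : 'I_1) = 0 :> 'I_n.+1 by exact/val_inj.
by have := @row_mxEl R 1 1 n (const_mx x) v 0 0; rewrite e [RHS]mxE.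
Qed.

Lemma rV_unconsK n : cancel (@rV_uncons n) (@rV_cons n).
Proof.
move=> v; apply/rowP => i; rewrite /rV_cons/=.
have [j ->|j ->] := @split_ordP 1 n i.
  apply: etrans (row_mxEl _ _ _ _) _; rewrite mxE/= ord1.
  by congr (v _ _); exact/val_inj.
by apply: etrans (row_mxEr _ _ _ _) _; rewrite mxE.
Qed.

Lemma measurable_rV_cons n : measurable_fun setT (@rV_cons n).
Proof.
apply: measurable_rVP => i.
have [j ->|j ->] := @split_ordP 1 n i.
  rewrite (_ : (fun _ => _) = fst); first exact: measurable_fst.
  by apply/funext => x; apply: etrans (row_mxEl _ _ _ _) _; rewrite mxE.
rewrite (_ : (fun _ => _) = (fun v : 'rV[R]_n => v 0 j) \o snd).
  by apply: measurableT_comp; [exact: measurable_coord|exact: measurable_snd].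
by apply/funext => x; exact: row_mxEr.
Qed.

Lemma measurable_rV_uncons n : measurable_fun setT (@rV_uncons n).
Proof.
apply: measurable_fun_pair; first exact: measurable_coord.
apply: measurable_rVP => i.
rewrite (_ : (fun _ => _) = (fun v : 'rV[R]_n.+1 => v 0 (rshift 1 i))).
  exact: measurable_coord.
by apply/funext => x; rewrite mxE.
Qed.

Section step.
Context n (m : {sigma_finite_measure set 'rV[R]_n -> \bar R}).

Definition lebesgue_rV_step :=
  pushforward (lebesgue_measure \x m)%E (@rV_cons n).

Let step0 : lebesgue_rV_step set0 = 0%E.
Proof. by rewrite /lebesgue_rV_step /pushforward preimage_set0 measure0. Qed.

Let step_ge0 A : (0 <= lebesgue_rV_step A)%E.
Proof. by rewrite /lebesgue_rV_step /pushforward measure_ge0. Qed.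

Let preim A : measurable A -> measurable (@rV_cons n @^-1` A).
Proof.
by move=> mA; rewrite -[X in measurable X]setTI; exact: measurable_rV_cons.
Qed.

Let step_sigma_additive : semi_sigma_additive lebesgue_rV_step.
Proof.
move=> F mF tF mUF; rewrite /lebesgue_rV_step /pushforward preimage_bigcup.
apply: measure_semi_sigma_additive.
- by move=> k; exact: preim.
- apply/trivIsetP => /= i j _ _ ij; rewrite -preimage_setI.
  by move/trivIsetP : tF => /(_ _ _ _ _ ij) ->//; rewrite preimage_set0.
- by rewrite -preimage_bigcup; exact: preim.
Qed.

HB.instance Definition _ := isMeasure.Build _ _ _ lebesgue_rV_step
  step0 step_ge0 step_sigma_additive.

Let step_sigma_finite : sigma_finite setT lebesgue_rV_step.
Proof.
have /sigma_finiteP[F [TF ndF Foo]] := sigma_finiteT (@lebesgue_measure R).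
have /sigma_finiteP[G [TG ndG Goo]] := sigma_finiteT m.
exists (fun k => @rV_uncons n @^-1` (F k `*` G k)).
  rewrite -preimage_bigcup; apply/esym; rewrite -subTset => v _ /=.
  have [i _ Fi] : (\bigcup_i F i) (v 0 0) by rewrite -TF.
  have [j _ Gj] : (\bigcup_i G i) (rsubmx (v : 'rV[R]_(1 + n))) by rewrite -TG.
  exists (maxn i j) => //; split => /=.
  - by move: Fi; exact/subsetPset/ndF/leq_maxl.
  - by move: Gj; exact/subsetPset/ndG/leq_maxr.
move=> k; have [mF Fk] := Foo k; have [mG Gk] := Goo k.
have mFG : measurable (F k `*` G k) by exact: measurableX.
split.
  by rewrite -[X in measurable X]setTI; exact: measurable_rV_uncons.
rewrite /lebesgue_rV_step /pushforward -comp_preimage.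
rewrite (_ : _ \o _ = id); last exact/funext/rV_consK.
by rewrite preimage_id product_measure1E// lte_mul_pinfty// ge0_fin_numE.
Qed.

HB.instance Definition _ := Measure_isSigmaFinite.Build _ _ _ lebesgue_rV_step
  step_sigma_finite.

End step.

Fixpoint lebesgue_rV n : {sigma_finite_measure set 'rV[R]_n -> \bar R} :=
  if n is n'.+1 then lebesgue_rV_step (lebesgue_rV n') else \d_(0 : 'rV[R]_0).

End lebesgue_rV.

Section functionals.
Context (R : realType) (V : normedModType R).

(* Weakly convergent sequences are used; lower semicontinuity with respect to
   the weak topology implies this property. *)
Definition weakly_lsc (f : V -> R) :=
  forall (u_ : nat -> V) (u : V),
    (forall l : {linear V -> R}, continuous l -> l (u_ n) @[n --> \oo] --> l u) ->
    ((f u)%:E <= limn_einf (fun n => (f (u_ n))%:E))%E.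

Definition affinely_minorized (f : V -> R) :=
  exists (g : {linear V -> R}) (c : R), continuous g /\ forall u, g u + c <= f u.

(* The derivative is continuous for the operator norm of the dual space. *)
Definition continuously_differentiable (f : V -> R) :=
  (forall u, differentiable f u) /\
  forall u e, 0 < e ->
    \forall v \near u, forall h, `|'d f v h - 'd f u h| <= e * `|h|.

End functionals.

Section domain.
Context (R : realType) (d : nat).
Implicit Types (D : set 'rV[R]_d).

(* The library norm on row vectors is the maximum norm. *)
Definition enorm (x : 'rV[R]_d) : R := Num.sqrt (\sum_(i < d) x 0 i ^+ 2).

(* Near every boundary point, D is the strict epigraph of a Lipschitz function
   in rotated coordinates y := x *m Q, y_j being the vertical coordinate. *)
Definition lipschitz_boundary D :=
  forall x0, closure D x0 -> ~ D x0 ->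
    exists (Q : 'M[R]_d) (j : 'I_d) (g : 'rV[R]_d.-1 -> R) (L r : R),
      [/\ Q *m Q^T = 1%:M, L.-lipschitz g, 0 < r &
        forall x, enorm (x - x0) < r ->
          (D x <-> g (col' j (x *m Q)) < (x *m Q) 0 j)].

Record lipschitz_domain := LipschitzDomain {
  dom :> set 'rV[R]_d;
  dom_nonempty : dom !=set0;
  dom_open : open dom;
  dom_connected : connected dom;
  dom_bounded : bounded_set dom;
  dom_lipschitz : lipschitz_boundary dom }.

End domain.

Section sobolev.
Context (R : realType) (d : nat).
Implicit Types (D : set 'rV[R]_d) (u w : 'rV[R]_d -> R) (s : R).

Local Notation leb := (lebesgue_rV R d).

(* Elements of function spaces over D are represented by Borel functions
   on R^d, only the values on D being relevant. *)
Definition L2_on D : set ('rV[R]_d -> R) := [set w : 'rV[R]_d -> R |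
  measurable_fun setT w /\ (\int[leb]_(x in D) ((w x) ^+ 2)%:E < +oo)%E].

Definition L2_dot D u w : R := \int[leb]_(x in D) (u x * w x).

Definition gamma_fun (a : R) : R :=
  \int[lebesgue_measure]_(t in `]0, +oo[) (t `^ (a - 1) * expR (- t)).

Definition c_ds s : R :=
  s * 2 `^ (2 * s) * gamma_fun (s + d%:R / 2) /
  (trigo.pi `^ (d%:R / 2) * gamma_fun (1 - s)).

Definition gagliardo_kernel s (z : 'rV[R]_d * 'rV[R]_d) : R :=
  (enorm (z.1 - z.2) `^ (d%:R + 2 * s))^-1.

Definition Hs D s : set ('rV[R]_d -> R) := [set w : 'rV[R]_d -> R | L2_on D w /\
  (\int[(leb \x leb)%E]_(z in D `*` D)
     (`|w z.1 - w z.2| ^+ 2 * gagliardo_kernel s z)%:E < +oo)%E].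

Definition Hs_dot D s u w : R :=
  L2_dot D u w + c_ds s / 2 *
  \int[(leb \x leb)%E]_(z in D `*` D)
    ((u z.1 - u z.2) * (w z.1 - w z.2) * gagliardo_kernel s z).

Definition partial (i : 'I_d) u : 'rV[R]_d -> R := 'D_(delta_mx 0 i) u.

Fixpoint Ck (k : nat) u : Prop :=
  continuous u /\
  if k is k'.+1 then
    forall i, (forall x, derivable u x (delta_mx 0 i)) /\ Ck k' (partial i u)
  else True.

Definition test_fun D : set ('rV[R]_d -> R) := [set phi : 'rV[R]_d -> R |
  (forall k, Ck k phi) /\
  exists K, [/\ compact K, K `<=` D & forall x, ~ K x -> phi x = 0]].

Definition Hs0 D s : set ('rV[R]_d -> R) := [set w : 'rV[R]_d -> R | Hs D s w /\
  forall e, 0 < e -> exists2 phi, test_fun D phi &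
    Num.sqrt (Hs_dot D s (w - phi) (w - phi)) < e].

Definition Hs_tilde D s : set ('rV[R]_d -> R) := [set w : 'rV[R]_d -> R | Hs setT s w /\
  {ae leb, forall x, ~ D x -> w x = 0}].

Definition weak_gradient D u (g : 'I_d -> 'rV[R]_d -> R) :=
  forall i phi, test_fun D phi ->
    L2_dot D u (partial i phi) = - L2_dot D (g i) phi.

Definition H1_grad D u (g : 'I_d -> 'rV[R]_d -> R) :=
  [/\ L2_on D u, forall i, L2_on D (g i) & weak_gradient D u g].

(* [u] belongs to the closure of the test functions in H^1, with gradient [g] *)
Definition H10_grad D u (g : 'I_d -> 'rV[R]_d -> R) :=
  H1_grad D u g /\
  forall e, 0 < e -> exists2 phi, test_fun D phi &
    L2_dot D (u - phi) (u - phi) +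
    \sum_(i < d) L2_dot D (g i - partial i phi) (g i - partial i phi) < e.

(* An orthonormal basis of L^2(D) made of (weak) eigenfunctions of the Dirichlet
   Laplacian. *)
Record dirichlet_eigenbasis D := DirichletEigenbasis {
  eigenfun : nat -> 'rV[R]_d -> R;
  eigenval : nat -> R;
  eigenfunP : forall n, exists2 g, H10_grad D (eigenfun n) g &
    forall v h, H10_grad D v h ->
      \sum_(i < d) L2_dot D (g i) (h i) = eigenval n * L2_dot D (eigenfun n) v;
  eigenfun_orthonormal : forall m n,
    L2_dot D (eigenfun m) (eigenfun n) = (m == n)%:R;
  eigenfun_complete : forall w, L2_on D w ->
    let rest N := w - \sum_(n < N) L2_dot D w (eigenfun n) *: eigenfun n in
    L2_dot D (rest N) (rest N) @[N --> \oo] --> (0 : R) }.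

(* The expansion w = \sum_n w_n phi_n holds for every w in L^2(D) since the
   basis is complete. *)
Definition HHs D (E : dirichlet_eigenbasis D) s : set ('rV[R]_d -> R) :=
  [set w : 'rV[R]_d -> R | L2_on D w /\
   (\sum_(0 <= n <oo) (eigenval E n `^ s * L2_dot D w (eigenfun E n) ^+ 2)%:E
     < +oo)%E].

Definition HHs_dot D (E : dirichlet_eigenbasis D) s u w : R :=
  limn [series eigenval E n `^ s * L2_dot D u (eigenfun E n) *
               L2_dot D w (eigenfun E n)]_n.

Variant fractional_space D :=
  | SpaceHs | SpaceHs0 | SpaceHsTilde
  | SpaceSpectral of dirichlet_eigenbasis D.

Context (D : set 'rV[R]_d) (s : R) (W : fractional_space D).

Definition inW : set ('rV[R]_d -> R) :=
  match W with
  | SpaceHs => Hs D s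
  | SpaceHs0 => Hs0 D s
  | SpaceHsTilde => Hs_tilde D s
  | SpaceSpectral E => HHs E s
  end.

Definition W_dot u w : R :=
  match W with
  | SpaceHs | SpaceHs0 => Hs_dot D s u w
  | SpaceHsTilde => Hs_dot setT s u w
  | SpaceSpectral E => HHs_dot E s u w
  end.

Definition W_norm w : R := Num.sqrt (W_dot w w).

(* Boundedness entails that [l] does not depend on the representatives. *)
Definition W_dual (l : ('rV[R]_d -> R) -> R) :=
  (forall a u w, inW u -> inW w -> l (a *: u + w) = a * l u + l w) /\
  exists C, forall w, inW w -> `|l w| <= C * W_norm w.

End sobolev.

Section control.
Context (R : realType) (d : nat) (Om : lipschitz_domain R d) (T : R).

Lemma measurable_cylinder :
  measurable ((`]0, T[ : set (measurableTypeR R)) `*` (Om : set 'rV[R]_d)).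
Proof.
by apply: measurableX => //; exact: open_measurable_rV (@dom_open _ _ Om).
Qed.

Definition cyl_measure : {measure set (measurableTypeR R * 'rV[R]_d) -> \bar R} :=
  mrestr (lebesgue_measure \x lebesgue_rV R d)%E measurable_cylinder.

Definition Uspace := LspaceType2 cyl_measure.

Definition U_dot (u v : measurableTypeR R * 'rV[R]_d -> R) : R :=
  \int[cyl_measure]_z (u z * v z).

Definition nonneg (v : measurableTypeR R * 'rV[R]_d -> R) :=
  {ae cyl_measure, forall z, 0 <= v z}.

(* [mu] belongs to the convex subdifferential at [vbar] of the indicator
   function of the cone of nonnegative functions *)
Definition subdiff_IC (vbar : measurableTypeR R * 'rV[R]_d -> R) (mu : Uspace) :=
  nonneg vbar /\
  forall v : Uspace, nonneg v -> U_dot mu (fun z => v z - vbar z) <= 0.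

Context (s : R) (W : fractional_space Om).

Definition admissible (u : Uspace) (w : 'rV[R]_d -> R) :=
  inW s W w /\ {ae cyl_measure, forall z, `|u z| <= w z.2}.

Context (f : Uspace -> R) (alpha beta gamma p : R).

Definition Phi0 (u : Uspace) (w : 'rV[R]_d -> R) : R :=
  f u + alpha / 2 * `|u| ^+ 2 + beta / 2 * W_norm s W w ^+ 2 +
  gamma * \int[lebesgue_rV R d]_(x in Om) (`|w x| `^ p).

Definition local_solution (ubar : Uspace) (wbar : 'rV[R]_d -> R) :=
  admissible ubar wbar /\
  exists2 rho, 0 < rho &
    forall u w, admissible u w ->
      `|u - ubar| <= rho -> W_norm s W (w - wbar) <= rho ->
      Phi0 ubar wbar <= Phi0 u w.

End control.

(* Main.v *)
(* Let g be the Riesz representative of f'(ubar) + alpha ubar in U.  The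
   multipliers can be written down: mu1 = - max(-g, 0) and mu2 = - max(g, 0), so
   that mu1 - mu2 = g, and lambda is defined by stationarity with respect to z.
   Since (ubar, wbar) is a minimiser, two families of competitors give the rest.
   - With w = wbar fixed, moving ubar towards - sign(g) wbar is admissible; the
     first-order condition says that the nonpositive numbers
     (mu1, wbar - ubar)_U and (mu2, wbar + ubar)_U have a nonnegative sum, hence
     both vanish.
   - (1 + t)(ubar, wbar) is admissible for small t of both signs; the derivative
     at t = 0, where the sparsity term is (1 + t)^p times a constant, gives the
     value of lambda at wbar.
   That lambda belongs to W* needs the embedding of W in L^2, which for the
   spectral space is a positive lower bound on the Dirichlet eigenvalues. *)
Require Import Defs.
From mathcomp Require Import all_boot all_order all_algebra.
From mathcomp Require Import all_classical all_reals all_analysis.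
From mathcomp Require Import measurable_realfun ring lra.
Set Implicit Arguments.
Unset Strict Implicit.
Unset Printing Implicit Defensive.
Import Order.TTheory GRing.Theory Num.Theory.
Import numFieldNormedType.Exports.
Local Open Scope classical_set_scope.
Local Open Scope ring_scope.

(** * Square integrable functions *)

(** The integrand |w|^p need not be differentiable where w vanishes, so first-order conditions are
    not taken in general directions of W. Once mu1 and mu2 are fixed, stationarity prescribes lambda
    on all of W; only its value at wbar is left to identify, and scalings suffice for that because
    the sparsity term is homogeneous. The signs of the multipliers are forced: stationarity in v
    asks for mu1 - mu2 = g, and the normal cone of nonnegative functions asks for mu1, mu2 <= 0. The
    competitor - sign(g) wbar minimises v -> (g, v)_U under |v| <= wbar, which is why a single
    comparison with ubar settles both complementarity products. Elements of W are functions, not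
    classes, and a divergent integral or series takes the value 0. The forms are therefore treated
    as linear only on a set where everything converges, and as semidefinite. The Gagliardo and
    spectral forms are both reduced to L^2 or l^2 products by moving the square root of the weight
    into each factor. *)

Section semi_inner_product.
Context (R : realType) (V : lmodType R) (P : set V) (B : V -> V -> R).
Hypothesis P_lin : forall a u v, P u -> P v -> P (a *: u + v).
Hypothesis B_linr : forall a u v w, P u -> P v -> P w ->
  B u (a *: v + w) = a * B u v + B u w.
Hypothesis B_sym : forall u v, B u v = B v u.
Hypothesis B_ge0 : forall u, P u -> 0 <= B u u.

Lemma semi_inner_sqr (t : R) u v : P u -> P v ->
  B (t *: u + v) (t *: u + v) = t ^+ 2 * B u u + 2 * t * B u v + B v v.
Proof.
move=> Pu Pv; have Puv := P_lin t Pu Pv.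
rewrite B_linr// ![B (_ + _) _]B_sym !B_linr// (B_sym v u); ring.
Qed.

(** The discriminant argument, with the degenerate case [B u u = 0] treated apart because [B] is
    only semidefinite. Linearity is assumed on [P] alone, as integrals and series are additive only
    where they converge. *)
Lemma cauchy_schwarz u v : P u -> P v ->
  `|B u v| <= Num.sqrt (B u u) * Num.sqrt (B v v).
Proof.
move=> Pu Pv; rewrite -sqrtrM ?B_ge0// -sqrtr_sqr; apply: ler_wsqrtr.
have h t : 0 <= t ^+ 2 * B u u + 2 * t * B u v + B v v.
  by rewrite -semi_inner_sqr//; apply/B_ge0/P_lin.
have [u0|u0] := eqVneq (B u u) 0.
  suff -> : B u v = 0 by rewrite u0 expr0n mul0r.
  apply/eqP/negPn/negP => uv.
  (* With [B u u = 0] the expression is affine in [t], and this [t] gives it the value -1. *)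
  have := h (- (B v v + 1) / (2 * B u v)).
  rewrite u0 mulr0 add0r.
  have -> : 2 * (- (B v v + 1) / (2 * B u v)) * B u v = - (B v v + 1) by field.
  lra.
have u1 : 0 < B u u by rewrite lt0r u0 B_ge0.
(* The minimiser of the quadratic in [t]; the minimum is the Gram determinant divided by [B u u]. *)
have := h (- B u v / B u u).
have -> : (- B u v / B u u) ^+ 2 * B u u + 2 * (- B u v / B u u) * B u v + B v v
  = (B u u * B v v - B u v ^+ 2) / B u u by field.
by rewrite pmulr_lge0 ?invr_gt0// subr_ge0.
Qed.

End semi_inner_product.

Section square_integrable.
Context dT (T : measurableType dT) (R : realType).
Context (mu : {measure set T -> \bar R}).
Context (D : set T) (mD : measurable D).
Implicit Types u v w : T -> R.

(** Measurability is asked on [D] only, so that functions on the domain, Gagliardo quotients on [D]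
    times [D] and classes on the cylinder are all instances. *)
Definition sq_integrable : set (T -> R) := [set u : T -> R |
  measurable_fun D u /\ (\int[mu]_(x in D) ((u x) ^+ 2)%:E < +oo)%E].

Definition dotL2 u v : R := \int[mu]_(x in D) (u x * v x).

Lemma sq_integrableP u :
  sq_integrable u <-> measurable_fun D u /\
    mu.-integrable D (EFin \o (fun x => u x ^+ 2)).
Proof.
split=> -[mu_ h]; split => //.
  apply/integrableP; split.
    by apply/measurable_EFinP; exact: measurable_funX.
  by under eq_integral do rewrite /= ger0_norm ?sqr_ge0//.
move/integrableP : h => [_].
by under eq_integral do rewrite /= ger0_norm ?sqr_ge0//.
Qed.

Lemma integrable_mul u v : sq_integrable u -> sq_integrable v ->
  mu.-integrable D (EFin \o (fun x => u x * v x)).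
Proof.
move=> /sq_integrableP[mu_ iu] /sq_integrableP[mv iv].
apply: (le_integrable mD _ _ (integrableD mD iu iv)).
  by apply/measurable_EFinP; exact: measurable_funM.
move=> x Dx /=; rewrite lee_fin normrM [leRHS]ger0_norm ?addr_ge0 ?sqr_ge0//.
rewrite -(real_normK (num_real (u x))) -(real_normK (num_real (v x))).
have := sqr_ge0 (`|u x| - `|v x|); have := normr_ge0 (u x).
by have := normr_ge0 (v x); nra.
Qed.

Lemma sq_integrable_lin a u v : sq_integrable u -> sq_integrable v ->
  sq_integrable (a *: u + v).
Proof.
move=> u2 v2.
have [mu_ iu] := (sq_integrableP _).1 u2;
  have [mv iv] := (sq_integrableP _).1 v2.
have iuv := integrable_mul u2 v2.
apply/sq_integrableP; split.
  by apply: measurable_funD => //; apply: measurable_funM => //;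
    exact: measurable_cst.
have := integrableD mD (integrableD mD (integrableZl mD (a ^+ 2) iu)
  (integrableZl mD (2 * a) iuv)) iv.
apply: eq_integrable => // x _ /=; rewrite -!EFinM -!EFinD; congr EFin.
rewrite !fctE /GRing.scale/=; ring.
Qed.

Lemma dotL2C u v : dotL2 u v = dotL2 v u.
Proof. by apply: eq_Rintegral => x _; rewrite mulrC. Qed.

Lemma dotL2_linr a u v w : sq_integrable u -> sq_integrable v ->
  sq_integrable w -> dotL2 u (a *: v + w) = a * dotL2 u v + dotL2 u w.
Proof.
move=> u2 v2 w2; rewrite /dotL2 -RintegralZl//; last exact: integrable_mul.
rewrite -RintegralD//; last 2 first.
- have := integrableZl mD a (integrable_mul u2 v2).
  by apply: eq_integrable => // x _ /=; rewrite EFinM.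
- exact: integrable_mul.
apply: eq_Rintegral => x _; rewrite !fctE /GRing.scale/=; ring.
Qed.

Lemma dotL2_ge0 u : 0 <= dotL2 u u.
Proof. by apply: Rintegral_ge0 => x _; rewrite -expr2 sqr_ge0. Qed.

Lemma dotL2_EFin u v : sq_integrable u -> sq_integrable v ->
  (dotL2 u v)%:E = (\int[mu]_(x in D) (u x * v x)%:E)%E.
Proof.
by move=> u2 v2; rewrite fineK// integrable_fin_num//; exact: integrable_mul.
Qed.

Lemma dotL2_cauchy_schwarz u v : sq_integrable u -> sq_integrable v ->
  `|dotL2 u v| <= Num.sqrt (dotL2 u u) * Num.sqrt (dotL2 v v).
Proof.
move=> u2 v2; apply: (cauchy_schwarz (P := sq_integrable)) => //.
- exact: sq_integrable_lin.
- exact: dotL2_linr.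
- exact: dotL2C.
- by move=> w _; exact: dotL2_ge0.
Qed.

Lemma dotL2_sqr t u v : sq_integrable u -> sq_integrable v ->
  dotL2 (t *: u + v) (t *: u + v) =
  t ^+ 2 * dotL2 u u + 2 * t * dotL2 u v + dotL2 v v.
Proof.
apply: semi_inner_sqr.
- exact: sq_integrable_lin.
- exact: dotL2_linr.
- exact: dotL2C.
Qed.

Lemma sq_integrableZ a u : sq_integrable u -> sq_integrable (a *: u).
Proof.
move=> u2; have := sq_integrable_lin (a - 1) u2 u2.
by rewrite scalerBl scale1r subrK.
Qed.

Lemma sq_integrableD u v : sq_integrable u -> sq_integrable v ->
  sq_integrable (u + v).
Proof. by move=> u2 v2; have := sq_integrable_lin 1 u2 v2; rewrite scale1r. Qed.

Lemma sq_integrableB u v : sq_integrable u -> sq_integrable v ->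
  sq_integrable (u - v).
Proof.
by move=> u2 v2; have := sq_integrable_lin (-1) v2 u2; rewrite scaleN1r addrC.
Qed.

Lemma sq_integrable_le u v : measurable_fun D u ->
  (forall x, D x -> `|u x| <= `|v x|) -> sq_integrable v -> sq_integrable u.
Proof.
move=> mu_ uv /sq_integrableP[mv iv]; apply/sq_integrableP; split => //.
apply: le_integrable iv => //.
  by apply/measurable_EFinP; exact: measurable_funX.
by move=> x /uv ?; rewrite /= lee_fin !normrX lerXn2r// nnegrE.
Qed.

Lemma dotL2Zr a u v : sq_integrable u -> sq_integrable v ->
  dotL2 u (a *: v) = a * dotL2 u v.
Proof.
move=> u2 v2; rewrite -RintegralZl//; last exact: integrable_mul.
by apply: eq_Rintegral => x _; rewrite fctE /GRing.scale/= mulrCA.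
Qed.

Lemma dotL2Dr u v w : sq_integrable u -> sq_integrable v ->
  sq_integrable w -> dotL2 u (v + w) = dotL2 u v + dotL2 u w.
Proof.
by move=> u2 v2 w2; have := dotL2_linr 1 u2 v2 w2; rewrite scale1r mul1r.
Qed.

Lemma dotL2Br u v w : sq_integrable u -> sq_integrable v ->
  sq_integrable w -> dotL2 u (v - w) = dotL2 u v - dotL2 u w.
Proof.
move=> u2 v2 w2; have := dotL2_linr (-1) u2 w2 v2.
by rewrite scaleN1r addrC mulN1r [RHS]addrC.
Qed.

(** Holds for infinite integrals too: if the integral of [u] is +oo, both real-valued integrals are
    0. It can thus be applied before finiteness is known. *)
Lemma ge0_RintegralZl (k : R) u : measurable_fun D u ->
  (forall x, D x -> 0 <= u x) -> 0 <= k ->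
  \int[mu]_(x in D) (k * u x) = k * \int[mu]_(x in D) u x.
Proof.
move=> mu_ u0 k0; rewrite /Rintegral.
under eq_integral do rewrite EFinM.
rewrite ge0_integralZl_EFin//; last exact/measurable_EFinP.
have : (0 <= \int[mu]_(x in D) (u x)%:E)%E by exact: integral_ge0.
case: (\int[mu]_(x in D) (u x)%:E)%E => [r| |]//= _; rewrite mulr0.
by rewrite mulry; case: sgrP => _; rewrite ?mul0e ?mul1e ?mulN1e.
Qed.

Lemma dotL2_sqrZ a u : measurable_fun D u ->
  dotL2 (a *: u) (a *: u) = a ^+ 2 * dotL2 u u.
Proof.
move=> mu_; rewrite -ge0_RintegralZl ?sqr_ge0//.
- by apply: eq_Rintegral => x _; rewrite fctE /GRing.scale/=; ring.
- exact: measurable_funM.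
- by move=> x _; rewrite -expr2 sqr_ge0.
Qed.

Lemma sq_integrable_ae u v : measurable_fun D u -> measurable_fun D v ->
  ae_eq mu D u v -> sq_integrable u -> sq_integrable v.
Proof.
move=> mu_ mv uv [_ ui]; split => //; apply: le_lt_trans ui.
rewrite le_eqVlt; apply/orP; left; apply/eqP.
apply: ge0_ae_eq_integral => //.
- by apply/measurable_EFinP; exact: measurable_funX.
- by apply/measurable_EFinP; exact: measurable_funX.
- by move=> x _; rewrite lee_fin sqr_ge0.
- by move=> x _; rewrite lee_fin sqr_ge0.
- by apply: filterS uv => x h /h ->.
Qed.

Lemma dotL2_ae u u' v : measurable_fun D u -> measurable_fun D u' ->
  measurable_fun D v -> ae_eq mu D u u' -> dotL2 u v = dotL2 u' v.
Proof.
move=> mu_ mu' mv uu'; congr fine; apply: ae_eq_integral => //.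
- by apply/measurable_EFinP; exact: measurable_funM.
- by apply/measurable_EFinP; exact: measurable_funM.
- by apply: filterS uu' => x h /h ->.
Qed.

End square_integrable.

Lemma dotL2_ge0_ae dT (T : measurableType dT) (R : realType)
    (mu : {measure set T -> \bar R}) (u v : T -> R) :
  measurable_fun setT u -> measurable_fun setT v ->
  {ae mu, forall x, 0 <= u x * v x} -> 0 <= dotL2 mu setT u v.
Proof.
move=> mu_ mv uv0.
have mM : measurable_fun setT (fun x => u x * v x) by exact: measurable_funM.
rewrite /dotL2 /Rintegral.
rewrite (@ae_eq_integral _ _ _ _ _ (fun x => `|u x * v x|%:E))//.
- by apply: Rintegral_ge0 => x _; exact: normr_ge0.
- exact/measurable_EFinP.
- by apply/measurable_EFinP; exact: measurableT_comp.
- by apply: filterS uv0 => x h _; rewrite ger0_norm.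
Qed.

Lemma dotL2_le0_ae dT (T : measurableType dT) (R : realType)
    (mu : {measure set T -> \bar R}) (u v : T -> R) :
  sq_integrable mu setT u -> sq_integrable mu setT v ->
  {ae mu, forall x, u x * v x <= 0} -> dotL2 mu setT u v <= 0.
Proof.
move=> u2 v2 uv0; rewrite -oppr_ge0 -mulN1r -dotL2Zr//.
have [mu_ _] := u2; have [mZv _] := sq_integrableZ measurableT (-1) v2.
apply: dotL2_ge0_ae => //; apply: filterS uv0 => x.
by rewrite fctE /GRing.scale/= mulN1r mulrN oppr_ge0.
Qed.

Lemma eq_dotL2_ae dT (T : measurableType dT) (R : realType)
    (mu : {measure set T -> \bar R}) (u v u' v' : T -> R) :
  measurable_fun setT u -> measurable_fun setT v ->
  measurable_fun setT u' -> measurable_fun setT v' ->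
  {ae mu, forall x, u x * v x = u' x * v' x} ->
  dotL2 mu setT u v = dotL2 mu setT u' v'.
Proof.
move=> mu_ mv mu' mv' e; congr fine; apply: ae_eq_integral => //.
- by apply/measurable_EFinP; exact: measurable_funM.
- by apply/measurable_EFinP; exact: measurable_funM.
- by apply: filterS e => x h _; rewrite h.
Qed.

(** * Inner product and norm on the classes of L^2 *)

Section Lspace2.
Context dT (T : measurableType dT) (R : realType).
Context (mu : {measure set T -> \bar R}).
Local Notation L2 := (LspaceType2 mu).
Local Notation dot := (dotL2 mu setT).
Implicit Types u v w : L2.

Lemma Lspace2_sq_integrable u : sq_integrable mu setT u.
Proof.
apply/sq_integrableP; split; first exact: Lspace_measurable.
exact: Lfun2_integrable_sqr (Lspace_Lfun u).
Qed.
Hint Resolve Lspace2_sq_integrable : core.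

Lemma Lspace2_sqr_norm u : `|u| ^+ 2 = dot u u.
Proof.
rewrite Lspace_normE -powR_mulrn ?fine_ge0 ?Lnorm_ge0//.
have N_fin : ('N[mu]_2%:E[EFin \o u] \is a fin_num)%E.
  rewrite ge0_fin_numE ?Lnorm_ge0//.
  by have := Lspace_Lfun u; rewrite inE => /andP[_]; rewrite inE.
apply: EFin_inj; rewrite -poweR_EFin fineK// powR_Lnorm ?pnatr_eq0//.
rewrite dotL2_EFin//; apply: eq_integral => x _ /=.
by rewrite powR_mulrn ?normr_ge0// real_normK ?num_real// expr2.
Qed.

Lemma sq_integrable_Lspace2 (u : T -> R) : sq_integrable mu setT u ->
  exists v : L2, ae_eq mu setT v u.
Proof.
move=> [mu_ ui]; have uL : u \in Lfun mu 2%:E.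
  rewrite inE; apply/andP; split; rewrite inE//= /finite_norm.
  rewrite unlock poweR_lty//.
  under eq_integral do rewrite /= powR_mulrn ?normr_ge0//
    real_normK ?num_real//.
  exact: ui.
by exists (Lclass (Lfun_Sub (lee1n 2) uL)); exact: LclassE.
Qed.

Lemma Lspace2_linE a u v :
  ae_eq mu setT (a *: u + v : L2) (a *: (u : T -> R) + v).
Proof.
near=> x => _; rewrite fctE (near (LspaceD (a *: u) v) x)//.
by rewrite (near (LspaceZ a u) x).
Unshelve. all: by end_near. Qed.

Lemma Lspace2_dot_linr a u v w :
  dot w (a *: u + v : L2) = a * dot w u + dot w v.
Proof.
rewrite -dotL2_linr// dotL2C [RHS]dotL2C.
apply: (dotL2_ae measurableT _ _ _ (Lspace2_linE a u v)).
- exact: Lspace_measurable.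
- by have [] := sq_integrable_lin measurableT a
    (Lspace2_sq_integrable u) (Lspace2_sq_integrable v).
- exact: Lspace_measurable.
Qed.

Lemma Lspace2_sqr_normD t u v :
  `|t *: u + v| ^+ 2 = t ^+ 2 * `|u| ^+ 2 + 2 * t * dot u v + `|v| ^+ 2.
Proof.
rewrite !Lspace2_sqr_norm.
apply: (@semi_inner_sqr R L2 setT (fun u v : L2 => dot u v)) => //.
- by move=> *; exact: Lspace2_dot_linr.
- by move=> *; exact: dotL2C.
Qed.

End Lspace2.
#[global] Hint Resolve Lspace2_sq_integrable : core.

(** * Completeness of L^2 and the Riesz representation *)

(** The n-th increment is at most [Num.sqrt C] times 2^-n, so the telescoping series converges
    absolutely. *)
Lemma cvgn_of_weighted_increments (R : realType) (a : R^nat) (C : R) :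
  (forall n, 4 ^+ n * (a n.+1 - a n) ^+ 2 <= C) -> cvgn a.
Proof.
move=> aC.
have C0 : 0 <= C by apply: le_trans (aC 0); rewrite mulr_ge0 ?sqr_ge0.
have aC' n : `|telescope a n| <= geometric (Num.sqrt C) 2^-1 n.
  rewrite /= /telescope -(@ler_pM2l _ (2 ^+ n)) ?exprn_gt0//.
  rewrite mulrCA -exprMn mulfV ?pnatr_eq0// expr1n mulr1.
  rewrite -(@ler_pXn2r _ 2) ?nnegrE ?mulr_ge0 ?exprn_ge0// ?sqrtr_ge0//.
  rewrite sqr_sqrtr// exprMn real_normK ?num_real// -exprM mulnC exprM.
  by rewrite (_ : 2 ^+ 2 = 4 :> R); [exact: aC|rewrite -natrX].
rewrite (_ : a = (fun n => a 0%N + series (telescope a) n)); last first.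
  by apply/funext => n; exact: eq_sum_telescope.
apply: is_cvgD; first exact: is_cvg_cst.
apply/normed_cvg.
apply: (series_le_cvg _ _ aC') => [n|n|]; first exact: normr_ge0.
  by rewrite /= mulr_ge0 ?sqrtr_ge0 ?exprn_ge0.
by apply: is_cvg_geometric_series; rewrite ger0_norm//; lra.
Qed.

Lemma limn_einf_le (R : realType) (u : (\bar R)^nat) (c : \bar R) :
  (forall n, (u n <= c)%E) -> (limn_einf u <= c)%E.
Proof.
move=> uc; rewrite limn_einf_lim; apply: lime_le; first exact: is_cvg_einfs.
apply: nearW => n; apply: le_trans (uc n); apply: ereal_inf_lbound.
by exists n => //=.
Qed.

Section completeness.
Context dT (T : measurableType dT) (R : realType).
Context (mu : {measure set T -> \bar R}).
Local Notation L2 := (LspaceType2 mu).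
Local Notation dot := (dotL2 mu setT).

Lemma Lspace2_dotB (u v : L2) :
  dot ((u : T -> R) - (v : T -> R)) ((u : T -> R) - (v : T -> R)) =
  `|u - v| ^+ 2.
Proof.
have -> : (u : T -> R) - (v : T -> R) = (-1) *: (v : T -> R) + u.
  by rewrite scaleN1r addrC.
have -> : u - v = (-1) *: v + u by rewrite scaleN1r addrC.
by rewrite dotL2_sqr// Lspace2_sqr_normD !Lspace2_sqr_norm.
Qed.

(* Riesz-Fischer: the weighted sum of the squared increments is integrable, so
   that the sequence converges almost everywhere; Fatou's lemma then gives the
   rate of convergence in norm. *)
Lemma Lspace2_complete (u : nat -> L2) :
  (forall n, `|u n.+1 - u n| <= 4^-1 ^+ n) ->
  exists v : L2, forall n, `|v - u n| <= 2 * 4^-1 ^+ n.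
Proof.
move=> u_inc.
have u_dist n m : `|u (n + m)%N - u n| <= 2 * 4^-1 ^+ n.
  (* The factor [1 - 4^-1 ^+ m] leaves room for the next increment in the induction. Summing the
     geometric series would give 4/3 in place of 2. *)
  suff : `|u (n + m)%N - u n| <= 2 * 4^-1 ^+ n * (1 - 4^-1 ^+ m).
    move=> /le_trans; apply; apply: ler_piMr;
      first by rewrite mulr_ge0 ?exprn_ge0.
    by rewrite lerBlDr lerDl exprn_ge0.
  elim: m => [|m IH]; first by rewrite addn0 subrr normr0 expr0 subrr mulr0.
  rewrite addnS -(subrKA (u (n + m)%N)).
  apply: le_trans (ler_normD _ _) _; apply: le_trans (lerD (u_inc _) IH) _.
  rewrite exprS exprD; have : 0 <= 4^-1 ^+ n * 4^-1 ^+ m :> R.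
    by rewrite mulr_ge0// exprn_ge0.
  set A := 4^-1 ^+ n; set B := 4^-1 ^+ m; nra.
pose h n : T -> R := (u n.+1 : T -> R) - (u n : T -> R).
have h2 n : sq_integrable mu setT (h n) by exact: sq_integrableB.
have mh n : measurable_fun setT (h n) by have [] := h2 n.
have hn n : dot (h n) (h n) <= (4^-1 ^+ n) ^+ 2.
  by rewrite Lspace2_dotB lerXn2r// nnegrE// exprn_ge0.
(* The weight 4^n is light enough for the integrals to be summable, the n-th being at most 4^-n, and
   heavy enough to force geometric decay of the increments wherever the sum is finite. *)
pose g n x : \bar R := (4 ^+ n * (h n x * h n x))%:E.
have mg n : measurable_fun setT (g n).
  by apply/measurable_EFinP; apply: measurable_funM => //;
    exact: measurable_funM.
have g0 n x : (0 <= g n x)%E.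
  by rewrite lee_fin mulr_ge0 ?exprn_ge0// -expr2 sqr_ge0.
pose G x := (\sum_(n <oo) g n x)%E.
have mG : measurable_fun setT G.
  rewrite /G [X in measurable_fun _ X](_ : _ =
      (fun x => \sum_(i <oo | i \in xpredT) g i x)%E).
    by apply: ge0_emeasurable_sum => // *.
  by apply/funext => x; apply: eq_eseriesl => i.
have G0 x : (0 <= G x)%E by apply: nneseries_ge0.
have iG : mu.-integrable setT G.
  apply/integrableP; split => //.
  under eq_integral do rewrite gee0_abs//.
  rewrite integral_nneseries//.
  apply: (@le_lt_trans _ _ (\sum_(n <oo) (2 / (2 ^ (n + 1))%:R)%:E)%E).
    apply: lee_nneseries => [n _ _|n _]; first exact: integral_ge0.
    under eq_integral do rewrite /g EFinM.
    rewrite integralZl//; last exact: integrable_mul.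
    rewrite -dotL2_EFin// -EFinM lee_fin.
    apply: (@le_trans _ _ (4 ^+ n * (4^-1 ^+ n) ^+ 2)).
      by rewrite ler_pM2l ?exprn_gt0.
    rewrite expr2 mulrA -exprMn mulfV ?pnatr_eq0// expr1n mul1r.
    rewrite addn1 expnS natrM invfM mulrA mulfV ?pnatr_eq0// mul1r.
    by rewrite natrX -exprVn lerXn2r ?nnegrE//; lra.
  by rewrite (cvg_lim _ (@cvg_geometric_eseries_half R 2 0))// ltry.
pose A := setT `&` [set x | G x \is a fin_num].
have mA : measurable A by exact: emeasurable_fin_num.
have aeA : {ae mu, forall x, A x}.
  by apply: filterS (integrable_ae measurableT iG) => x h'; split => //;
    exact: h'.
(* Cutting off outside [A] makes the sequence converge at every point, so that its limit is
   measurable. *)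
pose F n x := (u n : T -> R) x * \1_A x.
have mF n : measurable_fun setT (F n).
  by apply: measurable_funM => //; exact: Lspace_measurable.
have cF x : cvgn (F ^~ x).
  rewrite /F indicE; case: (boolP (x \in A)) => [/set_mem[_ /= Gx]|_].
    under [F in cvgn F]eq_fun do rewrite mulr1.
    apply: (@cvgn_of_weighted_increments _ _ (fine (G x))) => n.
    rewrite -lee_fin fineK// /G;
      apply: le_trans (nneseries_lim_ge n.+1 _) => //.
    by rewrite big_nat_recr//= leeDr// sume_ge0.
  by under [F in cvgn F]eq_fun do rewrite mulr0; exact: is_cvg_cst.
pose v0 x := limn (F ^~ x).
have mv0 : measurable_fun setT v0.
  exact: measurable_fun_cvg mF (fun x _ => cF x).
have aeF n : ae_eq mu setT (u n) (F n).
  by apply: filterS aeA => x Ax _; rewrite /F indicE mem_set// mulr1.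
have F2 n : sq_integrable mu setT (F n).
  apply: (sq_integrable_ae measurableT _ _ (aeF n)) => //.
  exact: Lspace_measurable.
have dF n m :
    dot (F (n + m)%N - F n) (F (n + m)%N - F n) <= (2 * 4^-1 ^+ n) ^+ 2.
  have mB : measurable_fun setT (F (n + m)%N - F n) by exact: measurable_funB.
  have mB' : measurable_fun setT ((u (n + m)%N : T -> R) - (u n : T -> R)).
    by apply: measurable_funB; exact: Lspace_measurable.
  have e : ae_eq mu setT (F (n + m)%N - F n)
      ((u (n + m)%N : T -> R) - (u n : T -> R)).
    by apply: ae_eq_sub; exact: ae_eq_sym.
  rewrite (dotL2_ae measurableT mB mB' mB e) dotL2C.
  rewrite (dotL2_ae measurableT mB mB' mB' e) Lspace2_dotB.
  by rewrite lerXn2r ?nnegrE ?mulr_ge0 ?exprn_ge0.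
have fat n :
    (\int[mu]_x ((v0 x - F n x) ^+ 2)%:E <= ((2 * 4^-1 ^+ n) ^+ 2)%:E)%E.
  pose k m x := ((F (n + m)%N x - F n x) ^+ 2)%:E.
  have -> : (\int[mu]_x ((v0 x - F n x) ^+ 2)%:E =
             \int[mu]_x limn_einf (k ^~ x))%E.
    apply: eq_integral => x _; apply/esym.
    have -> // := @cvg_limn_einf_sup R (k ^~ x) ((v0 x - F n x) ^+ 2)%:E.
    apply: cvg_EFin; first exact: nearW.
    have Fm : F (n + m)%N x @[m --> \oo] --> v0 x.
      under eq_fun do rewrite addnC.
      by have := cF x; rewrite -(cvg_shiftn n (F ^~ x)).
    by rewrite /comp /=; apply: cvgM; apply: cvgB => //; exact: cvg_cst.
  apply: le_trans (fatou mu measurableT _ _) _ => //=.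
  - move=> m; apply/measurable_EFinP; apply: measurable_funX.
    exact: measurable_funB.
  - by move=> m x _; rewrite lee_fin sqr_ge0.
  apply: limn_einf_le => m; move: (dF n m); rewrite -lee_fin; apply: le_trans.
  by rewrite dotL2_EFin//; exact: sq_integrableB.
have w2 n : sq_integrable mu setT (v0 - F n).
  split; first exact: measurable_funB.
  exact: le_lt_trans (fat n) (ltry _).
have v2 : sq_integrable mu setT v0.
  by have := sq_integrableD measurableT (w2 0%N) (F2 0%N); rewrite subrK.
have [v vE] := sq_integrable_Lspace2 v2.
exists v => n; rewrite -(@ler_pXn2r _ 2) ?nnegrE ?mulr_ge0 ?exprn_ge0//.
have mB := (w2 n).1.
have mB' : measurable_fun setT ((v : T -> R) - (u n : T -> R)).
  by apply: measurable_funB; exact: Lspace_measurable.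
have e : ae_eq mu setT ((v : T -> R) - (u n : T -> R)) (v0 - F n).
  exact: (ae_eq_sub vE (aeF n)).
rewrite -Lspace2_dotB (dotL2_ae measurableT mB' mB mB' e) dotL2C.
rewrite (dotL2_ae measurableT mB' mB mB e) -lee_fin dotL2_EFin//.
exact: fat.
Qed.

(** Direct method for [J v = |v|^2 - 2 l v]: continuity of [l] bounds [J] below, the parallelogram
    identity makes a minimising sequence converge, and the vanishing first variation at the limit is
    the representation. *)
Lemma riesz_Lspace2 (l : {linear L2 -> R}) : continuous l ->
  exists g : L2, forall v : L2, l v = dot g v.
Proof.
move=> lc.
have [M M0 lM] : exists2 M, 0 < M & forall v, `|l v| <= M * `|v|.
  have /linear_boundedP/pinfty_ex_gt0[M M0 lM] :=
    (@continuous_linear_bounded _ _ _ 0 l (lc 0)).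
  by exists M.
have lZ a v : l (a *: v) = a * l v by exact: linearZ.
have lD v w : l (v + w) = l v + l w by exact: linearD.
pose J (v : L2) := `|v| ^+ 2 - 2 * l v.
have J_ge v : - M ^+ 2 <= J v.
  have := lM v; rewrite ler_norml /J => /andP[_ lv].
  have := sqr_ge0 (M - `|v|); nra.
have infJ : has_inf (range J).
  split; first by exists (J 0), 0.
  by exists (- M ^+ 2) => _ [v _ <-].
pose m := inf (range J).
have m_le v : m <= J v by apply: (ge_inf infJ.2); exists v.
(* With A = 4^-n, this tolerance and the parallelogram identity bound the squared increment by A^2
   (1 + 1/16) / 2, hence the increment by A, as [Lspace2_complete] requires. *)
have /= uex n : {v : L2 | J v < m + (4^-1 ^+ n) ^+ 2 / 4}.
  apply: cid; have e0 : 0 < (4^-1 ^+ n) ^+ 2 / 4 :> R.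
    by rewrite divr_gt0// ?exprn_gt0// invr_gt0.
  by have [_ [v _ <-] Jv] := inf_adherent e0 infJ; exists v.
pose u n := sval (uex n).
have uJ n : J (u n) < m + (4^-1 ^+ n) ^+ 2 / 4 by exact: svalP (uex n).
have parallelogram (v w : L2) :
    `|v - w| ^+ 2 = 2 * J v + 2 * J w - 4 * J (2^-1 *: (v + w)).
  have -> : v - w = (-1) *: w + v by rewrite scaleN1r addrC.
  rewrite /J normrZ exprMn lZ lD.
  have -> : v + w = 1 *: w + v by rewrite scale1r addrC.
  have h0 : 0 <= 2^-1 :> R by rewrite invr_ge0.
  by rewrite !Lspace2_sqr_normD (ger0_norm h0); field.
have u_inc n : `|u n.+1 - u n| <= 4^-1 ^+ n.
  rewrite -(@ler_pXn2r _ 2) ?nnegrE ?exprn_ge0// parallelogram.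
  have := m_le (2^-1 *: (u n.+1 + u n)); have := uJ n; have := uJ n.+1.
  rewrite (exprS _ n); set A := 4^-1 ^+ n;
    have : 0 <= A ^+ 2 by rewrite sqr_ge0.
  lra.
have [g gu] := Lspace2_complete u_inc.
have un : u n @[n --> \oo] --> g.
  apply/cvgrPdist_le => e e0.
  have : (geometric 2 4^-1 : R^nat) @ \oo --> (0 : R).
    by apply: cvg_geometric; rewrite ger0_norm//; lra.
  move=> /cvgrPdist_le/(_ e e0); apply: filterS => n; rewrite sub0r normrN.
  by move=> /(le_trans _); apply; apply: le_trans (gu n) (ler_norm _).
have Jg : J g <= m.
  have cJ : J (u n) @[n --> \oo] --> J g.
    apply: cvgB; first by apply: cvgM; exact: cvg_norm.
    by apply: cvgM; [exact: cvg_cst|exact: cvg_comp un (lc g)].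
  have cm : m + (4^-1 ^+ n) ^+ 2 / 4 @[n --> \oo] --> m.
    rewrite -[X in _ --> X]addr0; apply: cvgD; first exact: cvg_cst.
    rewrite (_ : (fun n => _) = geometric 4^-1 (4^-1 ^+ 2)).
      by apply: cvg_geometric; rewrite ger0_norm//; lra.
    by apply/funext => n; rewrite /= mulrC -!exprM mulnC.
  apply: (ler_cvg_to cJ cm).
  by apply: nearW => n; exact: ltW.
exists g => v.
have h t : 0 <= t ^+ 2 * `|v| ^+ 2 + 2 * t * (dot g v - l v).
  have := le_trans Jg (m_le (t *: v + g)).
  rewrite /J Lspace2_sqr_normD lD lZ dotL2C; lra.
apply/eqP; rewrite eq_sym -subr_eq0; apply/negPn/negP => c0.
set c := dot g v - l v in h c0.
have N0 : 0 < `|v| ^+ 2 + 1 by rewrite ltr_wpDl ?sqr_ge0.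
(* Adding 1 keeps the denominator positive when [v] is zero; the value obtained is still
   negative. *)
have := h (- c / (`|v| ^+ 2 + 1)); set N := `|v| ^+ 2 in N0 *.
have -> : (- c / (N + 1)) ^+ 2 * N + 2 * (- c / (N + 1)) * c =
  - (c ^+ 2 * (N + 2) / (N + 1) ^+ 2) by field; rewrite gt_eqF.
rewrite oppr_ge0 leNgt => /negP; apply.
rewrite divr_gt0 ?exprn_gt0// mulr_gt0//; last by lra.
by rewrite lt0r sqrf_eq0 c0 sqr_ge0.
Qed.

End completeness.

(** * Fractional Sobolev and spectral spaces *)

Section summable_squares.
Context (R : realType).
Implicit Types a b : R^nat.

Lemma nneseries_ltyP a : (forall n, 0 <= a n) ->
  ((\sum_(0 <= n <oo) (a n)%:E < +oo)%E <-> cvgn (series a)).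
Proof.
move=> a0.
have e : (fun n => (\sum_(0 <= k < n) (a k)%:E)%E) = EFin \o series a.
  by apply/funext => n; rewrite /= sumEFin.
split=> [h|h].
  apply: nondecreasing_is_cvgn; first by apply: nondecreasing_series => *.
  exists (fine (\sum_(0 <= n <oo) (a n)%:E)%E) => _ [n _ <-].
  rewrite -lee_fin fineK; last first.
    by rewrite ge0_fin_numE//; apply: nneseries_ge0 => k _ _; rewrite lee_fin.
  rewrite -sumEFin; apply: nneseries_lim_ge => k _ _; by rewrite lee_fin.
by rewrite e EFin_lim// ltry.
Qed.

Definition sq_summable : set (R^nat) :=
  [set a : R^nat | cvgn (series (fun n => a n ^+ 2))].

Lemma sq_summable_mul a b : sq_summable a -> sq_summable b ->
  cvgn (series (fun n => a n * b n)).
Proof.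
move=> a2 b2; apply/normed_cvg.
apply: (series_le_cvg _ _ _ (is_cvg_seriesD a2 b2)) => n.
- exact: normr_ge0.
- by rewrite /= addr_ge0 ?sqr_ge0.
rewrite [leRHS](_ : _ = a n ^+ 2 + b n ^+ 2)//= normrM.
rewrite -(real_normK (num_real (a n))) -(real_normK (num_real (b n))).
have := sqr_ge0 (`|a n| - `|b n|); have := normr_ge0 (a n).
by have := normr_ge0 (b n); nra.
Qed.

Definition dotl2 a b : R := limn (series (fun n => a n * b n)).

Lemma dotl2_linr t a b c : sq_summable a -> sq_summable b -> sq_summable c ->
  dotl2 a (t *: b + c) = t * dotl2 a b + dotl2 a c.
Proof.
move=> a2 b2 c2; have ab := sq_summable_mul a2 b2;
  have ac := sq_summable_mul a2 c2.
apply/cvg_lim => //.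
rewrite (_ : series _ = (fun n => t * series (fun n => a n * b n) n +
    series (fun n => a n * c n) n)); last first.
  apply/funext => n; rewrite /series/= mulr_sumr -big_split/=.
  by apply: eq_bigr => i _; rewrite !fctE /GRing.scale/=; ring.
by apply: cvgD => //; apply: cvgM => //; exact: cvg_cst.
Qed.

Lemma sq_summable_lin t a b : sq_summable a -> sq_summable b ->
  sq_summable (t *: a + b).
Proof.
move=> a2 b2; have ab := sq_summable_mul a2 b2.
rewrite /sq_summable/= (_ : series _ = (fun n =>
    t ^+ 2 * series (fun n => a n ^+ 2) n +
    2 * t * series (fun n => a n * b n) n + series (fun n => b n ^+ 2) n)).
  by apply: is_cvgD => //; apply: is_cvgD; apply: is_cvgM => //;
    exact: is_cvg_cst.
apply/funext => n; rewrite /series/= !mulr_sumr -!big_split/=.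
by apply: eq_bigr => i _; rewrite !fctE /GRing.scale/=; ring.
Qed.

Lemma dotl2_ge0 a : 0 <= dotl2 a a.
Proof.
rewrite /dotl2; case: (pselect (cvgn (series (fun n => a n * a n)))) => h.
  apply: limr_ge => //; apply: nearW => n; apply: sumr_ge0 => i _.
  by rewrite -expr2 sqr_ge0.
(* A divergent series has the default limit 0. *)
by rewrite dvgP.
Qed.

End summable_squares.

(** * L^2 over a domain and the Gagliardo form *)

Section function_space.
Context (R : realType) (d : nat).
Implicit Types (D : set 'rV[R]_d) (u w : 'rV[R]_d -> R).
Local Notation leb := (lebesgue_rV R d).

Lemma L2_on_sq_integrable D u : L2_on D u -> sq_integrable leb D u.
Proof. by move=> [mu ui]; split => //; exact: measurable_funS mu. Qed.

Lemma L2_on_lin D a u w : measurable D -> L2_on D u -> L2_on D w ->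
  L2_on D (a *: u + w).
Proof.
move=> mD u2 w2.
have [_ h] := sq_integrable_lin mD a (L2_on_sq_integrable u2)
  (L2_on_sq_integrable w2).
split => //; apply: measurable_funD; last by case: w2.
by apply: measurable_funM; [exact: measurable_cst|case: u2].
Qed.

Lemma L2_on_subset D D' u : measurable D -> measurable D' -> D `<=` D' ->
  L2_on D' u -> L2_on D u.
Proof.
move=> mD mD' DD' [mu ui]; split => //; apply: le_lt_trans ui.
apply: ge0_subset_integral => //.
- by apply/measurable_EFinP; apply: measurable_funX; exact: measurable_funS mu.
- by move=> x _; rewrite lee_fin sqr_ge0.
Qed.

Lemma L2_dot_subset D D' u : measurable D -> measurable D' -> D `<=` D' ->
  L2_on D' u -> L2_dot D u u <= L2_dot D' u u.
Proof.
move=> mD mD' DD' u2; have := L2_on_subset mD mD' DD' u2 => u2'.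
rewrite -lee_fin !(dotL2_EFin (mu := leb))//; try exact: L2_on_sq_integrable.
apply: ge0_subset_integral => //.
- by apply/measurable_EFinP; apply: measurable_funM;
    apply: measurable_funS u2.1.
- by move=> x _; rewrite lee_fin -expr2 sqr_ge0.
Qed.

(** Splitting the kernel evenly between the two factors turns the Gagliardo form into an L^2 product
    over [D] times [D], so that bilinearity and positivity are inherited from [dotL2]. *)
Definition gagliardo_quotient (s : R) u (z : 'rV[R]_d * 'rV[R]_d) : R :=
  (u z.1 - u z.2) * Num.sqrt (gagliardo_kernel s z).

Lemma gagliardo_kernel_ge0 (s : R) (z : 'rV[R]_d * 'rV[R]_d) :
  0 <= gagliardo_kernel s z.
Proof. by rewrite invr_ge0 powR_ge0. Qed.

Lemma gagliardo_quotient_mul (s : R) u w z :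
  (u z.1 - u z.2) * (w z.1 - w z.2) * gagliardo_kernel s z =
  gagliardo_quotient s u z * gagliardo_quotient s w z.
Proof.
rewrite -[in LHS](@sqr_sqrtr _ (gagliardo_kernel s z)) ?gagliardo_kernel_ge0//.
rewrite /gagliardo_quotient; ring.
Qed.

Lemma measurable_sqrt : measurable_fun setT (@Num.sqrt R).
Proof. by apply: nondecreasing_measurable => // x y; exact: ler_wsqrtr. Qed.

Lemma measurable_gagliardo_quotient (s : R) u :
  measurable_fun setT u -> measurable_fun setT (gagliardo_quotient s u).
Proof.
move=> mu; apply: measurable_funM.
  apply: measurable_funB; apply: (measurableT_comp mu).
  - exact: measurable_fst.
  - exact: measurable_snd.
apply: (measurableT_comp measurable_sqrt).
rewrite (_ : gagliardo_kernel s =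
    (fun z => enorm (z.1 - z.2) `^ (- (d%:R + 2 * s)))).
  apply: (measurableT_comp (measurable_powR _)).
  apply: (measurableT_comp measurable_sqrt).
  apply: measurable_sum => i; apply: measurable_funX.
  rewrite (_ : (fun _ => _) =
    (fun z : 'rV[R]_d * 'rV[R]_d => z.1 0 i - z.2 0 i)); last first.
    by apply/funext => z; rewrite !mxE.
  by apply: measurable_funB; apply: (measurableT_comp (measurable_coord i));
    [exact: measurable_fst|exact: measurable_snd].
by apply/funext => z; rewrite powRN.
Qed.

Lemma gagliardo_quotient_lin (s : R) a u w :
  gagliardo_quotient s (a *: u + w) =
  a *: gagliardo_quotient s u + gagliardo_quotient s w.
Proof.
apply/funext => z; rewrite /gagliardo_quotient !fctE /GRing.scale/=; ring.
Qed.

Local Notation leb2 := (leb \x leb)%E.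

Lemma HsP D (s : R) u : measurable D ->
  Hs D s u <->
  L2_on D u /\ sq_integrable leb2 (D `*` D) (gagliardo_quotient s u).
Proof.
move=> mD.
have e z : `|u z.1 - u z.2| ^+ 2 * gagliardo_kernel s z =
    gagliardo_quotient s u z ^+ 2.
  by rewrite real_normK ?num_real// [in RHS]expr2 -gagliardo_quotient_mul expr2.
split=> -[u2]; first (move=> h; split => //; split).
- apply: measurable_funS (measurable_gagliardo_quotient s u2.1) => //.
- by under eq_integral do rewrite -e.
by move=> [_ h]; split => //; under eq_integral do rewrite e.
Qed.

Lemma Hs_dotE D (s : R) u w : Hs_dot D s u w = dotL2 leb D u w +
  c_ds d s / 2 * dotL2 leb2 (D `*` D) (gagliardo_quotient s u)
    (gagliardo_quotient s w).
Proof.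
congr (_ + _ * _); apply: eq_Rintegral => z _.
exact: gagliardo_quotient_mul.
Qed.

Lemma c_ds_ge0 (s : R) : 0 <= s -> 0 <= c_ds d s.
Proof.
have gamma_ge0 (a : R) : 0 <= gamma_fun a.
  by apply: Rintegral_ge0 => t _; rewrite mulr_ge0 ?powR_ge0 ?expR_ge0.
move=> s0; rewrite divr_ge0// mulr_ge0 ?powR_ge0//.
by rewrite mulr_ge0// powR_ge0.
Qed.

Lemma Hs_lin D (s : R) a u w : measurable D ->
  Hs D s u -> Hs D s w -> Hs D s (a *: u + w).
Proof.
move=> mD /HsP-/(_ mD)[u2 u2'] /HsP-/(_ mD)[w2 w2']; apply/HsP => //.
rewrite gagliardo_quotient_lin; split; first exact: L2_on_lin.
by apply: sq_integrable_lin => //; exact: measurableX.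
Qed.

Lemma Hs_dot_linr D (s : R) a u v w : measurable D ->
  Hs D s u -> Hs D s v -> Hs D s w ->
  Hs_dot D s u (a *: v + w) = a * Hs_dot D s u v + Hs_dot D s u w.
Proof.
move=> mD /HsP-/(_ mD)[u2 u2'] /HsP-/(_ mD)[v2 v2'] /HsP-/(_ mD)[w2 w2'].
have mDD : measurable (D `*` D) by exact: measurableX.
rewrite !Hs_dotE gagliardo_quotient_lin !dotL2_linr//; first ring.
all: exact: L2_on_sq_integrable.
Qed.

Lemma Hs_dotC D (s : R) u w : Hs_dot D s u w = Hs_dot D s w u.
Proof. by rewrite !Hs_dotE dotL2C; congr (_ + _ * _); exact: dotL2C. Qed.

(* An integral that diverges contributes the junk value 0 on both sides. *)
Lemma Hs_dot_sqrZ D (s : R) a u : measurable D -> measurable_fun setT u ->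
  Hs_dot D s (a *: u) (a *: u) = a ^+ 2 * Hs_dot D s u u.
Proof.
move=> mD mu.
have qZ : gagliardo_quotient s (a *: u) = a *: gagliardo_quotient s u.
  by apply/funext => z; rewrite /gagliardo_quotient !fctE /GRing.scale/=; ring.
rewrite !Hs_dotE qZ !dotL2_sqrZ//; first ring.
- exact: measurableX.
- exact: measurable_funS (measurable_gagliardo_quotient s mu).
- exact: measurable_funS mu.
Qed.

Lemma L2_dot_le_Hs_dot D (s : R) u : 0 <= s -> L2_dot D u u <= Hs_dot D s u u.
Proof.
by move=> s0; rewrite Hs_dotE lerDl mulr_ge0 ?dotL2_ge0// divr_ge0// c_ds_ge0.
Qed.

Lemma Hs_dot_ge0 D (s : R) u : 0 <= s -> 0 <= Hs_dot D s u u.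
Proof.
by move=> s0; apply: le_trans (L2_dot_le_Hs_dot D u s0); exact: dotL2_ge0.
Qed.

End function_space.

(** * Test functions and the Poincare inequality *)

Section test_functions.
Context (R : realType) (d : nat).
Implicit Types (D : set 'rV[R]_d) (u w phi : 'rV[R]_d -> R).
Local Notation leb := (lebesgue_rV R d).

Lemma coord_le_norm (x : 'rV[R]_d) i : `|x 0 i| <= `|x|.
Proof.
have -> : `|x| = mx_norm x by []; rewrite mx_normrE.
exact: (@le_bigmax _ _ _ 0 (fun ij : 'I_1 * 'I_d => `|x ij.1 ij.2|) (0, i)).
Qed.

Lemma is_derive_coord (x v : 'rV[R]_d) i :
  is_derive x v (fun y => y 0 i) (v 0 i).
Proof.
have h : (fun h : R => h^-1 *: ((h *: v + x) 0 i - x 0 i)) @ 0^' --> v 0 i.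
  apply: cvg_near_cst; near=> h.
  rewrite !mxE addrK /GRing.scale/= mulrA mulVf ?mul1r//.
  by near: h; exact: nbhs_dnbhs_neq.
by split; [apply/cvg_ex; exists (v 0 i); exact: h|exact: cvg_lim h].
Unshelve. all: by end_near. Qed.

Lemma Ck_continuous k u : Ck k u -> continuous u.
Proof. by case: k => [|k] []. Qed.

Lemma Ck_partial k i u : Ck k.+1 u -> Ck k (partial i u).
Proof. by case=> _ /(_ i)[]. Qed.

Lemma Ck_derivable k i u x : Ck k.+1 u -> derivable u x (delta_mx 0 i).
Proof. by case=> _ /(_ i)[+ _]; exact. Qed.

Lemma CkW k u : Ck k.+1 u -> Ck k u.
Proof.
elim: k u => [|k IH] u uk; first by split => //; exact: Ck_continuous uk.
split; first exact: Ck_continuous uk.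
by move=> i; split => [x|]; [exact: Ck_derivable uk|exact/IH/Ck_partial].
Qed.

Lemma Ck_lin k (a : R) u w : Ck k u -> Ck k w -> Ck k (a *: u + w).
Proof.
have cl (v z : 'rV[R]_d -> R) :
    continuous v -> continuous z -> continuous (a *: v + z).
  by move=> cv cz x; exact: (cvgD (cvgM (cvg_cst a) (cv x)) (cz x)).
elim: k u w => [|k IH] u w uk wk.
  by split => //; apply: cl; [exact: Ck_continuous uk|exact: Ck_continuous wk].
split; first by apply: cl; [exact: Ck_continuous uk|exact: Ck_continuous wk].
move=> i.
have du x : derivable (a \*: u) x (delta_mx 0 i).
  by apply: derivableZ; exact: Ck_derivable uk.
have dw x : derivable w x (delta_mx 0 i) by exact: Ck_derivable wk.
split => [x|]; first exact: derivableD.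
rewrite (_ : partial i _ = a *: partial i u + partial i w).
  by apply: IH; exact: Ck_partial.
apply/funext => x; rewrite /partial !fctE.
by rewrite (deriveD (du x) (dw x)) deriveZ//; exact: Ck_derivable uk.
Qed.

Lemma Ck_cst0 k : Ck k (cst 0 : 'rV[R]_d -> R).
Proof.
elim: k => [|k IH]; first by split => //; exact: cst_continuous.
split; first exact: cst_continuous.
move=> i; split => [x|]; first exact: derivable_cst.
rewrite (_ : partial i _ = cst 0)//.
by apply/funext => x; rewrite /partial derive_cst.
Qed.

(** Multiplication by x_i, whose derivative in direction i is 1: the product rule then returns the
    function itself, which lets a weak gradient control the function. *)
Definition coord_mul i u : 'rV[R]_d -> R := fun x => x 0 i * u x.

Lemma partial_coord_mul i j u : (forall x, derivable u x (delta_mx 0 j)) ->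
  partial j (coord_mul i u) = (i == j)%:R *: u + coord_mul i (partial j u).
Proof.
move=> du; apply/funext => x; rewrite /partial /coord_mul.
have [cd cv] := is_derive_coord x (delta_mx 0 j) i.
rewrite (deriveM cd (du x)) cv mxE eqxx /= addrC [u x *: _]mulrC.
by rewrite eq_sym.
Qed.

Lemma Ck_coord_mul k i u : Ck k u -> Ck k (coord_mul i u).
Proof.
have cc v : continuous v -> continuous (coord_mul i v).
  by move=> cv x; exact: (cvgM (@coord_continuous R 1 d 0 i x) (cv x)).
elim: k u => [|k IH] u uk; first by split => //; apply: cc;
  exact: Ck_continuous uk.
split; first by apply: cc; exact: Ck_continuous uk.
move=> j; split => [x|].
  by apply: derivableM; [case: (is_derive_coord x (delta_mx 0 j) i)|
    exact: Ck_derivable uk].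
rewrite partial_coord_mul; last by move=> x; exact: Ck_derivable uk.
by apply: Ck_lin; [exact: CkW|exact/IH/Ck_partial].
Qed.

Lemma test_fun_coord_mul D i phi :
  test_fun D phi -> test_fun D (coord_mul i phi).
Proof.
move=> [phiC [K [cK KD phi0]]]; split; first by move=> k; exact: Ck_coord_mul.
by exists K; split => // x /phi0; rewrite /coord_mul => ->; rewrite mulr0.
Qed.

Lemma test_funZ D (a : R) phi : test_fun D phi -> test_fun D (a *: phi).
Proof.
move=> [phiC [K [cK KD phi0]]]; split.
  move=> k; have := Ck_lin a (phiC k) (Ck_cst0 k).
  by rewrite (_ : cst 0 = 0)// addr0.
by exists K; split => // x /phi0; rewrite fctE => ->; rewrite scaler0.
Qed.

Lemma continuous_measurable_rV u : continuous u -> measurable_fun setT u.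
Proof.
move=> /continuousP cu; apply: (measurability _ (RGenOpens.measurableE R)).
move=> _ [_ [a [b ->] <-]]; rewrite setTI; apply: open_measurable_rV.
exact/cu/interval_open.
Qed.

End test_functions.

(** * Bounded sets: finite measure and integrability of continuous functions *)

Section bounded_domain.
Context (R : realType).

Definition box n (M : R) := [set x : 'rV[R]_n | forall i, `|x 0 i| <= M].
Arguments box : clear implicits.

Lemma measurable_box n M : measurable (box n M).
Proof.
rewrite (_ : box n M = \bigcap_(i : 'I_n) [set x | `|x 0 i| <= M]).
  apply: fin_bigcap_measurable => [|i _]; first exact: finite_finset.
  have := @measurable_coord R n i measurableT _ (measurable_itv `[- M, M]).
  rewrite setTI; congr measurable; apply/seteqP.
  by split=> x /=; rewrite in_itv/= ler_norml.
by apply/seteqP; split => [x h i _|x h i]; [exact: h|exact: h i I].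
Qed.

(** Induction along the recursive construction of the measure: through [rV_cons], a box lies in the
    product of an interval and a box of one dimension less. *)
Lemma lebesgue_rV_box d (M : R) : (lebesgue_rV R d (box d M) < +oo)%E.
Proof.
have mbox n := @measurable_box n M.
elim: d => [|n IH] /=; first by rewrite diracE ltry.
rewrite /lebesgue_rV_step /pushforward.
apply: (@le_lt_trans _ _ ((lebesgue_measure \x lebesgue_rV R n)%E
   (`[- M, M]%classic `*` box n M))).
  apply: le_measure; rewrite ?inE.
  - rewrite -[X in measurable X]setTI.
    exact: (@measurable_rV_cons R n measurableT _ (mbox n.+1)).
  - by apply: measurableX => //; exact: mbox.
  move=> -[x v] /= h.
  have e := rV_consK (x, v); rewrite /rV_uncons in e.
  move: e => [e1 e2]; split => /=.
    by rewrite in_itv/= -ler_norml -e1; exact: h.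
  by move=> i; rewrite -e2 mxE; exact: h.
rewrite product_measure1E//; last exact: mbox.
rewrite lte_mul_pinfty// ge0_fin_numE//.
by rewrite /= lebesgue_measure_itv/=; case: ifP; rewrite ltry.
Qed.

Context (d : nat) (D : set 'rV[R]_d).
Hypotheses (mD : measurable D) (bD : bounded_set D).
Local Notation leb := (lebesgue_rV R d).

Lemma bounded_coord :
  exists2 M, 0 < M & forall x, D x -> forall i, `|x 0 i| <= M.
Proof.
have [M [_ DM]] := bD; exists (`|M| + 1); first by rewrite ltr_pwDr.
move=> x Dx i; apply: le_trans (coord_le_norm x i) _.
by apply: DM => //; apply: le_lt_trans (ler_norm _) _; rewrite ltrDl.
Qed.

Lemma bounded_lebesgue_lty : (leb D < +oo)%E.
Proof.
have [M M0 DM] := bounded_coord.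
apply: le_lt_trans (lebesgue_rV_box d M); apply: le_measure; rewrite ?inE//.
exact: measurable_box.
Qed.

(** A continuous function is bounded on a compact box containing [D], and [D] has finite measure. *)
Lemma continuous_L2_on (u : 'rV[R]_d -> R) : continuous u -> L2_on D u.
Proof.
move=> cu; have mu := continuous_measurable_rV cu; split => //.
have [M M0 DM] := bounded_coord.
have [B [_ uB]] : bounded_set (u @` box d M).
  apply: compact_bounded; apply: continuous_compact.
    exact: continuous_subspaceT.
  apply: bounded_closed_compact.
    exists M; split; first exact: num_real.
    move=> N MN x xM /=; apply: le_trans (ltW MN).
    have -> : `|x| = mx_norm x by []; rewrite mx_normrE.
    by apply/bigmax_leP; split => [|[i j] _]; [exact: ltW|rewrite (ord1 i)].
  rewrite (_ : box d M = \bigcap_i [set x | `|x 0 i| <= M]).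
    apply: closed_bigI => i _.
    have := @closed_comp _ _ (fun x : 'rV[R]_d => `|x 0 i|) [set y | y <= M].
    apply; last exact: closed_le.
    by move=> x _; exact: (cvg_norm (@coord_continuous R 1 d 0 i x)).
  by apply/seteqP; split => [x h i _|x h i]; [exact: h|exact: h i I].
have uB' x : D x -> `|u x| <= `|B| + 1.
  move=> Dx; apply: uB; last by exists x => // i; exact: DM.
  by apply: le_lt_trans (ler_norm _) _; rewrite ltrDl.
apply: (@le_lt_trans _ _ (\int[leb]_(x in D) ((`|B| + 1) ^+ 2)%:E)%E).
  apply: ge0_le_integral => //.
  - by move=> x _; rewrite lee_fin sqr_ge0.
  - by apply/measurable_EFinP; apply: measurable_funX;
      exact: measurable_funS mu.
  move=> x Dx; rewrite lee_fin -(real_normK (num_real (u x))).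
  by rewrite lerXn2r ?nnegrE ?addr_ge0//; exact: uB'.
rewrite integral_cst// lte_mul_pinfty ?lee_fin ?sqr_ge0//.
exact: bounded_lebesgue_lty.
Qed.
End bounded_domain.

Section poincare.
Context (R : realType) (d : nat) (D : set 'rV[R]_d).
Hypotheses (mD : measurable D) (bD : bounded_set D).
Local Notation leb := (lebesgue_rV R d).
Implicit Types (u v w : 'rV[R]_d -> R).

Lemma L2_on_coord_mul i u : L2_on D u -> L2_on D (coord_mul i u).
Proof.
move=> u2; have [M M0 DM] := bounded_coord bD.
have mc : measurable_fun setT (coord_mul i u).
  by apply: measurable_funM; [exact: measurable_coord|exact: u2.1].
have [] // := @sq_integrable_le _ _ _ leb D mD (coord_mul i u) (M *: u).
- exact: measurable_funS mc.
- move=> x Dx; rewrite /coord_mul fctE /GRing.scale/= !normrM.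
  by rewrite ler_wpM2r// (ger0_norm (ltW M0)); exact: DM.
- by apply: sq_integrableZ => //; exact: L2_on_sq_integrable.
Qed.

Lemma L2_dot_coord_mul_le i M u : 0 <= M ->
  (forall x, D x -> `|x 0 i| <= M) -> L2_on D u ->
  L2_dot D (coord_mul i u) (coord_mul i u) <= M ^+ 2 * L2_dot D u u.
Proof.
move=> M0 DM u2; have u2' := L2_on_sq_integrable u2.
have xu2 := L2_on_sq_integrable (L2_on_coord_mul i u2).
rewrite /L2_dot -RintegralZl//; last exact: integrable_mul.
apply: le_Rintegral => //; first exact: integrable_mul.
  have := integrableZl mD (M ^+ 2) (integrable_mul mD u2' u2').
  by apply: eq_integrable => // x _; rewrite /= EFinM.
move=> x Dx; rewrite /coord_mul mulrACA -!expr2 ler_wpM2r ?sqr_ge0//.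
by rewrite -(real_normK (num_real (x 0 i))) lerXn2r ?nnegrE//; exact: DM.
Qed.

Lemma L2_dot_coord_mulC i u v :
  L2_dot D (coord_mul i u) v = L2_dot D u (coord_mul i v).
Proof. by apply: eq_Rintegral => x _; rewrite /coord_mul; ring. Qed.

Lemma L2_dotDr u v w : L2_on D u -> L2_on D v -> L2_on D w ->
  L2_dot D u (v + w) = L2_dot D u v + L2_dot D u w.
Proof.
by move=> u2 v2 w2; apply: dotL2Dr => //; exact: L2_on_sq_integrable.
Qed.

Lemma L2_dotBr u v w : L2_on D u -> L2_on D v -> L2_on D w ->
  L2_dot D u (v - w) = L2_dot D u v - L2_dot D u w.
Proof.
by move=> u2 v2 w2; apply: dotL2Br => //; exact: L2_on_sq_integrable.
Qed.

Lemma L2_dot_le_sqrt u v e : sq_integrable leb D u -> sq_integrable leb D v ->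
  L2_dot D v v <= e -> `|L2_dot D u v| <= Num.sqrt (L2_dot D u u) * Num.sqrt e.
Proof.
move=> u2 v2 ve; apply: le_trans (dotL2_cauchy_schwarz mD u2 v2) _.
by rewrite ler_wpM2l ?sqrtr_ge0// ler_wsqrtr.
Qed.

(* Testing the weak gradient of u with x_i phi, where phi is a test function
   close to u, replaces the usual integration along lines. *)
Lemma H10_grad_coord_mul i u g : H10_grad D u g ->
  L2_dot D u u = - (2 * L2_dot D (coord_mul i u) (g i)).
Proof.
move=> [[u2 g2 wg] uapp]; have {}g2 := g2 i.
have uS := L2_on_sq_integrable u2; have gS := L2_on_sq_integrable g2.
have xuS := L2_on_sq_integrable (L2_on_coord_mul i u2).
have xgS := L2_on_sq_integrable (L2_on_coord_mul i g2).
set S := L2_dot D u u + 2 * L2_dot D (coord_mul i u) (g i).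
suff S0 : S = 0 by apply/eqP; rewrite -addr_eq0 -/S S0.
pose C := Num.sqrt (L2_dot D u u)
  + Num.sqrt (L2_dot D (coord_mul i u) (coord_mul i u))
  + Num.sqrt (L2_dot D (coord_mul i (g i)) (coord_mul i (g i))).
have C0 : 0 <= C by rewrite !addr_ge0 ?sqrtr_ge0.
have SC e : 0 < e -> `|S| <= C * Num.sqrt e.
  move=> e0; have [phi tphi phie] := uapp _ e0.
  have [phiC _] := tphi.
  have phi2 : L2_on D phi by apply: continuous_L2_on => //;
    exact: Ck_continuous (phiC 0%N).
  have dphi2 : L2_on D (partial i phi).
    apply: continuous_L2_on => //.
    exact: (@Ck_continuous R d 0 _ (Ck_partial i (phiC 1%N))).
  have phiS := L2_on_sq_integrable phi2;
    have dphiS := L2_on_sq_integrable dphi2.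
  have := wg i _ (test_fun_coord_mul i tphi).
  rewrite partial_coord_mul => [|x]; last first.
    exact: (@Ck_derivable R d 0 i phi x (phiC 1%N)).
  have xdphi2 := L2_on_coord_mul i dphi2.
  rewrite eqxx scale1r L2_dotDr// -!L2_dot_coord_mulC => id0.
  have e1 : L2_dot D (u - phi) (u - phi) <= e.
    apply: ltW; apply: le_lt_trans phie; rewrite lerDl sumr_ge0// => j _.
    exact: dotL2_ge0.
  have e2 : L2_dot D (g i - partial i phi) (g i - partial i phi) <= e.
    apply: ltW; apply: le_lt_trans phie.
    rewrite (bigD1 i)//= addrCA lerDl addr_ge0 ?dotL2_ge0// sumr_ge0// => j _.
    exact: dotL2_ge0.
  have uphiS := sq_integrableB mD uS phiS.
  have gdphiS := sq_integrableB mD gS dphiS.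
  (* The three terms containing [phi] sum to 0 by [id0], the weak gradient tested with x_i [phi]; so
     [S] consists of approximation errors only. *)
  have -> : S = L2_dot D u (u - phi) +
      L2_dot D (coord_mul i u) (g i - partial i phi) +
      L2_dot D (coord_mul i (g i)) (u - phi).
    have xu2 := L2_on_coord_mul i u2; have xg2 := L2_on_coord_mul i g2.
    rewrite /S !L2_dotBr//.
    rewrite (_ : L2_dot D (coord_mul i (g i)) u =
      L2_dot D (coord_mul i u) (g i)).
      by lra.
    by rewrite L2_dot_coord_mulC; exact: dotL2C.
  rewrite /C !mulrDl; apply: le_trans (ler_normD _ _) _; apply: lerD.
    by apply: le_trans (ler_normD _ _) _; apply: lerD; exact: L2_dot_le_sqrt.
  exact: L2_dot_le_sqrt.
apply/eqP; rewrite -normr_le0; apply/ler_addgt0Pr => e e0; rewrite add0r.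
(* With this tolerance the bound becomes [C * e / (C + 1)], which is at most [e], also when [C] is
   0. *)
have e1 : 0 < (e / (C + 1)) ^+ 2.
  by rewrite exprn_gt0// divr_gt0// ltr_wpDl.
apply: le_trans (SC _ e1) _; rewrite sqrtr_sqr ger0_norm; last first.
  by rewrite divr_ge0 ?ltW// ltr_wpDl.
by rewrite mulrCA ler_piMr ?(ltW e0)// ler_pdivrMr ?ltr_wpDl// mul1r lerDl.
Qed.

(** Cauchy-Schwarz in [H10_grad_coord_mul] gives A^2 <= 4 M^2 A G, with A and G the squared norms of
    u and of its i-th derivative; dividing by A finishes unless A = 0. *)
Lemma poincare i M u g : 0 <= M -> (forall x, D x -> `|x 0 i| <= M) ->
  H10_grad D u g -> L2_dot D u u <= 4 * M ^+ 2 * L2_dot D (g i) (g i).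
Proof.
move=> M0 DM ug; have [[u2 g2 _] _] := ug; have {}g2 := g2 i.
have uS := L2_on_sq_integrable u2; have gS := L2_on_sq_integrable g2.
have xuS := L2_on_sq_integrable (L2_on_coord_mul i u2).
have : `|L2_dot D (coord_mul i u) (g i)| <=
    Num.sqrt (L2_dot D (coord_mul i u) (coord_mul i u)) *
    Num.sqrt (L2_dot D (g i) (g i)) by exact: dotL2_cauchy_schwarz.
have := H10_grad_coord_mul i ug; have := L2_dot_coord_mul_le M0 DM u2.
set A := L2_dot D u u; set X := L2_dot _ (coord_mul _ _) (coord_mul _ _).
set G := L2_dot D (g i) (g i); set Y := L2_dot _ _ (g i) => XA AY YXG.
have A0 : 0 <= A by exact: dotL2_ge0.
have X0 : 0 <= X by exact: dotL2_ge0.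
have G0 : 0 <= G by exact: dotL2_ge0.
have AA : A ^+ 2 <= 4 * (M ^+ 2 * A * G).
  rewrite [in leLHS]AY sqrrN exprMn (_ : 2 ^+ 2 = 4); last ring.
  rewrite ler_pM2l// -(real_normK (num_real Y)).
  apply: (@le_trans _ _ (X * G)); last by rewrite ler_wpM2r.
  rewrite -(sqr_sqrtr X0) -(sqr_sqrtr G0) -exprMn.
  by rewrite lerXn2r ?nnegrE ?mulr_ge0 ?sqrtr_ge0.
have [->|A1] := eqVneq A 0; first by rewrite !mulr_ge0.
have {}A0 : 0 < A by rewrite lt0r A1.
rewrite -(ler_pM2l A0) -expr2; apply: le_trans AA _.
rewrite le_eqVlt; apply/orP; left.
by apply/eqP; ring.
Qed.

Hypothesis d_gt0 : (0 < d)%N.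

(** An eigenfunction tested with itself has its eigenvalue as Dirichlet energy, its norm being 1;
    the Poincare inequality in one coordinate direction bounds that energy below uniformly in
    [n]. *)
Lemma eigenval_lower_bound (E : dirichlet_eigenbasis D) :
  exists2 c, 0 < c & forall n, c <= eigenval E n.
Proof.
have [M M0 DM] := bounded_coord bD.
pose i := Ordinal d_gt0.
exists (4 * M ^+ 2)^-1; first by rewrite invr_gt0 mulr_gt0// exprn_gt0.
move=> n; have [g ug eg] := eigenfunP E n.
have := eg _ _ ug; rewrite eigenfun_orthonormal eqxx mulr1 => <-.
have := poincare (ltW M0) (fun x Dx => DM x Dx i) ug.
rewrite eigenfun_orthonormal eqxx => h.
rewrite -(@ler_pM2l _ (4 * M ^+ 2)) ?mulr_gt0 ?exprn_gt0// mulfV; last first.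
  by rewrite gt_eqF// mulr_gt0 ?exprn_gt0.
apply: le_trans h _; rewrite ler_pM2l ?mulr_gt0 ?exprn_gt0//.
rewrite (bigD1 i)//= lerDl sumr_ge0// => j _; exact: dotL2_ge0.
Qed.

End poincare.

(** * The spectral space and its embedding in L^2 *)

Section spectral_space.
Context (R : realType) (d : nat) (D : set 'rV[R]_d).
Hypotheses (mD : measurable D) (bD : bounded_set D).
Variables (E : dirichlet_eigenbasis D) (s : R).
Implicit Types (u v w : 'rV[R]_d -> R).
Local Notation coef u n := (L2_dot D u (eigenfun E n)).

Lemma eigenfun_L2_on n : L2_on D (eigenfun E n).
Proof. by have [g [[]]] := eigenfunP E n. Qed.

Lemma coef_lin a u w n : L2_on D u -> L2_on D w ->
  coef (a *: u + w) n = a * coef u n + coef w n.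
Proof.
have eS := L2_on_sq_integrable (eigenfun_L2_on n).
move=> /L2_on_sq_integrable u2 /L2_on_sq_integrable w2.
by rewrite /L2_dot -![Rintegral _ _ _]/(dotL2 _ D _ _) dotL2C dotL2_linr//
  !(dotL2C _ _ (eigenfun E n)).
Qed.

(** Removing the N-th mode from the remainder lowers its squared norm by the square of the N-th
    coefficient, and completeness of the basis sends that norm to 0. *)
Lemma parseval w : L2_on D w ->
  series (fun n => coef w n ^+ 2) @ \oo --> L2_dot D w w.
Proof.
move=> w2; pose rest N := w - \sum_(n < N) coef w n *: eigenfun E n.
have restS N : rest N.+1 = (- coef w N) *: eigenfun E N + rest N.
  by rewrite /rest big_ord_recr/= opprD addrA scaleNr addrC.
have rest0 : rest 0%N = w by rewrite /rest big_ord0 subr0.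
have rest2 N : L2_on D (rest N).
  elim: N => [|N IH]; first by rewrite rest0.
  by rewrite restS; apply: L2_on_lin => //; exact: eigenfun_L2_on.
have coef_rest N n : (N <= n)%N -> coef (rest N) n = coef w n.
  elim: N => [|N IH] Nn; first by rewrite rest0.
  rewrite restS coef_lin//; last exact: eigenfun_L2_on.
  by rewrite eigenfun_orthonormal ltn_eqF// mulr0 add0r IH// ltnW.
have norm_rest N :
    L2_dot D (rest N) (rest N) =
    L2_dot D w w - series (fun n => coef w n ^+ 2) N.
  elim: N => [|N IH]; first by rewrite rest0 /series/= big_geq// subr0.
  rewrite restS [LHS](dotL2_sqr mD); last 2 first.
  - exact/L2_on_sq_integrable/eigenfun_L2_on.
  - exact: L2_on_sq_integrable.
  rewrite -![dotL2 _ D _ _]/(L2_dot D _ _) IH eigenfun_orthonormal eqxx.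
  rewrite [L2_dot D _ (rest N)](dotL2C _ D) -[dotL2 _ D _ _]/(L2_dot D _ _)
    coef_rest//.
  by rewrite seriesSr/=; ring.
have restE : (fun N => L2_dot D w w - L2_dot D (rest N) (rest N)) =
    series (fun n => coef w n ^+ 2).
  by apply/funext => N; rewrite norm_rest; ring.
rewrite -restE -[X in _ --> X]subr0; apply: cvgB; first exact: cvg_cst.
exact: (eigenfun_complete E w2).
Qed.

(** The square root of the spectral weight is put into each factor, so that the spectral product
    becomes an l^2 product. *)
Definition weighted_coef u : R^nat :=
  fun n => Num.sqrt (eigenval E n `^ s) * coef u n.

Lemma weighted_coef_mul u w n : eigenval E n `^ s * coef u n * coef w n =
  weighted_coef u n * weighted_coef w n.
Proof.
rewrite -[in LHS](@sqr_sqrtr _ (eigenval E n `^ s)) ?powR_ge0//.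
rewrite /weighted_coef; ring.
Qed.

Lemma weighted_coef_lin a u w : L2_on D u -> L2_on D w ->
  weighted_coef (a *: u + w) = a *: weighted_coef u + weighted_coef w.
Proof.
move=> u2 w2; apply/funext => n; rewrite /weighted_coef coef_lin// !fctE.
by rewrite /GRing.scale/=; ring.
Qed.

Lemma HHs_dotE u w :
  HHs_dot E s u w = dotl2 (weighted_coef u) (weighted_coef w).
Proof.
congr (limn (series _)); apply/funext => n; exact: weighted_coef_mul.
Qed.

Lemma HHsP u : HHs E s u <-> L2_on D u /\ sq_summable (weighted_coef u).
Proof.
have e : (fun n => weighted_coef u n ^+ 2) =
    fun n => eigenval E n `^ s * coef u n ^+ 2.
  by apply/funext => n; rewrite expr2 -weighted_coef_mul expr2 mulrA.
by split=> -[u2 h]; split => //; move: h; rewrite /sq_summable/= e;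
  apply nneseries_ltyP => n; rewrite mulr_ge0 ?powR_ge0 ?sqr_ge0.
Qed.

Lemma HHs_lin a u w : HHs E s u -> HHs E s w -> HHs E s (a *: u + w).
Proof.
move=> /HHsP[u2 u2'] /HHsP[w2 w2']; apply/HHsP; split; first exact: L2_on_lin.
by rewrite weighted_coef_lin//; exact: sq_summable_lin.
Qed.

Lemma HHs_dot_linr a u v w : HHs E s u -> HHs E s v -> HHs E s w ->
  HHs_dot E s u (a *: v + w) = a * HHs_dot E s u v + HHs_dot E s u w.
Proof.
move=> /HHsP[u2 u2'] /HHsP[v2 v2'] /HHsP[w2 w2'].
by rewrite !HHs_dotE weighted_coef_lin// dotl2_linr.
Qed.

Lemma HHs_dotC u w : HHs_dot E s u w = HHs_dot E s w u.
Proof.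
rewrite !HHs_dotE; congr (limn (series _)).
by apply/funext => n; rewrite mulrC.
Qed.

Lemma HHs_dot_ge0 u : 0 <= HHs_dot E s u u.
Proof. by rewrite HHs_dotE dotl2_ge0. Qed.

Lemma L2_dot_le_HHs_dot : (0 < d)%N -> 0 <= s -> exists2 C, 0 <= C &
  forall w, HHs E s w -> L2_dot D w w <= C * HHs_dot E s w w.
Proof.
move=> d0 s0; have [c c0 cE] := eigenval_lower_bound mD bD d0 E.
have cs0 : 0 < c `^ s by rewrite powR_gt0.
exists (c `^ s)^-1; first by rewrite invr_ge0 ltW.
move=> w /HHsP[w2 w2']; rewrite ler_pdivlMl// HHs_dotE.
have := parseval w2 => /(cvgM (cvg_cst (c `^ s))) lim1.
have wC : cvgn (series (fun n => weighted_coef w n * weighted_coef w n)).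
  exact: sq_summable_mul.
apply: (ler_cvg_to lim1 wC); apply: nearW => N.
rewrite /series/= mulr_sumr; apply: ler_sum => n _.
rewrite -weighted_coef_mul -mulrA -expr2 ler_wpM2r ?sqr_ge0//.
apply: ge0_ler_powR => //; rewrite nnegrE; first exact: ltW.
exact: le_trans (ltW c0) (cE n).
Qed.

End spectral_space.

(** * Properties shared by the four choices of W *)

Section fractional_space_inner_product.
Context (R : realType) (d : nat) (D : set 'rV[R]_d) (s : R).
Hypotheses (mD : measurable D) (bD : bounded_set D).
Hypotheses (d_gt0 : (0 < d)%N) (s_ge0 : 0 <= s).
Variable W : fractional_space D.
Implicit Types (u v w : 'rV[R]_d -> R).

(* P is the ambient space, H^s over D or over R^d, of which H^s_0 and the tilde
   space are subspaces. *)
Lemma W_dot_semi_inner : exists P : set ('rV[R]_d -> R),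
  [/\ inW s W `<=` P,
      forall a u v, P u -> P v -> P (a *: u + v),
      forall a u v w, P u -> P v -> P w ->
        W_dot s W u (a *: v + w) = a * W_dot s W u v + W_dot s W u w,
      forall u v, W_dot s W u v = W_dot s W v u &
      forall u, P u -> 0 <= W_dot s W u u].
Proof.
have Hs_inner D' : measurable D' ->
  [/\ forall a u v, Hs D' s u -> Hs D' s v -> Hs D' s (a *: u + v),
      forall a u v w, Hs D' s u -> Hs D' s v -> Hs D' s w ->
        Hs_dot D' s u (a *: v + w) = a * Hs_dot D' s u v + Hs_dot D' s u w,
      forall u v, Hs_dot D' s u v = Hs_dot D' s v u &
      forall u, Hs D' s u -> 0 <= Hs_dot D' s u u].
  by move=> mD'; split=> *; [exact: Hs_lin|exact: Hs_dot_linr|exact: Hs_dotC|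
    exact: Hs_dot_ge0].
case: W => [||| E] /=.
- by have [] := Hs_inner _ mD; exists (Hs D s); split.
- by have [] := Hs_inner _ mD; exists (Hs D s); split => // u [].
- by have [] := Hs_inner _ measurableT; exists (Hs setT s); split => // u [].
- by exists (HHs E s); split=> // *; [exact: HHs_lin|exact: HHs_dot_linr|
    exact: HHs_dotC|exact: HHs_dot_ge0].
Qed.

Lemma W_dot_linr a u v w : inW s W u -> inW s W v -> inW s W w ->
  W_dot s W u (a *: v + w) = a * W_dot s W u v + W_dot s W u w.
Proof.
have [P [WP _ lin _ _]] := W_dot_semi_inner.
by move=> /WP u1 /WP v1 /WP w1; exact: lin.
Qed.

Lemma W_dot_ge0 u : inW s W u -> 0 <= W_dot s W u u.
Proof. by have [P [WP _ _ _ ge0]] := W_dot_semi_inner => /WP; exact: ge0. Qed.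

Lemma W_dot_cauchy_schwarz u v : inW s W u -> inW s W v ->
  `|W_dot s W u v| <= W_norm s W u * W_norm s W v.
Proof.
have [P [WP Plin lin sym ge0]] := W_dot_semi_inner => /WP u1 /WP v1.
exact: (cauchy_schwarz Plin).
Qed.

Lemma W_dotZ a u : inW s W u ->
  W_dot s W (a *: u) (a *: u) = a ^+ 2 * W_dot s W u u.
Proof.
have [P [WP Plin lin sym ge0]] := W_dot_semi_inner => /WP u1.
have := semi_inner_sqr Plin lin sym (a - 1) u1 u1.
by rewrite scalerBl scale1r subrK => ->; ring.
Qed.

Lemma W_normZ a u : inW s W u -> W_norm s W (a *: u) = `|a| * W_norm s W u.
Proof. by move=> uW; rewrite /W_norm W_dotZ// sqrtrM ?sqr_ge0// sqrtr_sqr. Qed.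

Lemma W_norm_sqr u : inW s W u -> W_norm s W u ^+ 2 = W_dot s W u u.
Proof. by move=> uW; rewrite sqr_sqrtr// W_dot_ge0. Qed.

Lemma inWZ a u : inW s W u -> inW s W (a *: u).
Proof.
(* A multiple is written as a combination of [u] with itself, so closure under [a *: u + w] applies
   directly. *)
have eZ : (a *: u = (a - 1) *: u + u) by rewrite scalerBl scale1r subrK.
case: W => [||| E] /= uW; first (by rewrite eZ; exact: Hs_lin); last first.
- by rewrite eZ; exact: HHs_lin.
- case: uW => uW u0; split; first by rewrite eZ; exact: Hs_lin.
  by apply: filterS u0 => x h /h; rewrite fctE => ->; rewrite scaler0.
case: uW => uW uapp; split; first by rewrite eZ; exact: Hs_lin.
move=> e e0; have e1 : 0 < e / (`|a| + 1) by rewrite divr_gt0// ltr_wpDl.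
have [phi tphi phie] := uapp _ e1; exists (a *: phi); first exact: test_funZ.
(* Homogeneity is taken in the form valid for all measurable functions, as [u - phi] has not been
   shown to have a finite Gagliardo seminorm. *)
rewrite -scalerBr Hs_dot_sqrZ//; last first.
  apply: measurable_funB; first by case: uW => -[].
  by apply: continuous_measurable_rV; exact: (Ck_continuous (tphi.1 0%N)).
rewrite sqrtrM ?sqr_ge0// sqrtr_sqr.
apply: (@le_lt_trans _ _ (`|a| * (e / (`|a| + 1)))).
  by rewrite ler_wpM2l// ltW.
by rewrite mulrCA gtr_pMr// ltr_pdivrMr ?ltr_wpDl// mul1r ltrDl.
Qed.

Lemma inW_L2_on u : inW s W u -> L2_on D u.
Proof.
case: W => [||| E] /=; [by case|by do 2 case|case=> -[u2 _] _|by case].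
exact: L2_on_subset u2.
Qed.

Lemma L2_dot_le_W_dot : exists2 C, 0 <= C &
  forall u, inW s W u -> L2_dot D u u <= C * W_dot s W u u.
Proof.
case: W => [||| E] /=; last exact: L2_dot_le_HHs_dot.
- by exists 1 => // u _; rewrite mul1r; exact: L2_dot_le_Hs_dot.
- by exists 1 => // u _; rewrite mul1r; exact: L2_dot_le_Hs_dot.
- exists 1 => // u [[u2 _] _]; rewrite mul1r.
  apply: le_trans (L2_dot_le_Hs_dot setT u s_ge0).
  exact: L2_dot_subset.
Qed.

End fractional_space_inner_product.

(** * Optimality conditions *)

Section first_order_conditions.
Context (R : realType).

Lemma one_sided_min_derive_ge0 (F : R -> R) (L delta : R) :
  is_derive (0 : R) 1 F L -> 0 < delta ->
  (forall t, 0 < t < delta -> F 0 <= F t) -> 0 <= L.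
Proof.
move=> [dF FL] delta0 Fmin.
have lim : (fun h => h^-1 *: ((F \o shift 0) (h *: 1) - F 0)) @ 0^'+ --> L.
  by apply: cvg_dnbhs_at_right; rewrite -FL; exact: dF.
apply: (cvgr_to_ge lim); near=> h.
have h0 : 0 < h by near: h; exact: nbhs_right_gt.
rewrite /GRing.scale/= mulr1 addr0 mulr_ge0 ?invr_ge0 ?(ltW h0)// subr_ge0.
by apply: Fmin; rewrite h0; near: h; exact: nbhs_right_lt.
Unshelve. all: by end_near. Qed.

Lemma local_min_derive_eq0 (F : R -> R) (L delta : R) :
  is_derive (0 : R) 1 F L -> 0 < delta ->
  (forall t, `|t| < delta -> F 0 <= F t) -> L = 0.
Proof.
move=> dF delta0 Fmin; apply/eqP; rewrite eq_le; apply/andP; split; last first.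
  apply: (one_sided_min_derive_ge0 dF delta0) => t /andP[t0 td].
  by apply: Fmin; rewrite gtr0_norm.
(* The one-sided condition for the reflected function gives the opposite sign. *)
rewrite -oppr_ge0; apply: (@one_sided_min_derive_ge0 (F \o -%R) _ delta) => //.
  have dN : is_derive (0 : R) 1 -%R (-1 : R) by exact: is_deriveNid.
  rewrite -mulrN1; apply: is_derive1_comp.
  by rewrite oppr0.
move=> t /andP[t0 td]; rewrite /= oppr0.
by apply: Fmin; rewrite normrN gtr0_norm.
Qed.

Lemma is_derive_along (V : normedModType R) (f : V -> R) (a v : V) :
  differentiable f a ->
  is_derive (0 : R) 1 (fun t => f (t *: v + a)) ('d f a v).
Proof.
move=> df; have /derivable1P dfv : derivable f a v by exact: diff_derivable.
split; first exact: dfv.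
rewrite -deriveE// /derive; set g1 := fun h => h^-1 *: _;
  set g2 := fun h => h^-1 *: _.
suff -> : g1 = g2 by []; apply/funext => h; rewrite /g1 /g2.
by rewrite /= scale0r add0r [h *: 1]mulr1 addr0.
Qed.

Lemma is_derive_power (p : R) : is_derive (0 : R) 1 (fun t => (t + 1) `^ p) p.
Proof.
have h : is_derive (shift (1 : R) 0) 1 (@powR R ^~ p) (p * (0 + 1) `^ (p - 1)).
  by apply: is_derive1_powR; rewrite /= add0r.
have := is_derive1_comp h (is_derive_shift 0 1 (1 : R)).
by rewrite add0r powR1 !mulr1.
Qed.

Lemma is_derive_sqr (a : R) :
  is_derive (0 : R) 1 (fun t => (t + a) ^+ 2) (2 * a).
Proof.
have := is_deriveX 2 (is_derive_shift 0 1 a).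
by rewrite /= add0r expr1 /GRing.scale/= mulr1.
Qed.

Lemma is_derive_comb (F G : R -> R) (a b k l : R) :
  is_derive (0 : R) 1 F k -> is_derive (0 : R) 1 G l ->
  is_derive (0 : R) 1 (fun t => a * F t + b * G t) (a * k + b * l).
Proof.
by move=> dF dG; exact: (is_deriveD (is_deriveZ a dF) (is_deriveZ b dG)).
Qed.

Lemma is_derive_quadratic (a b : R) :
  is_derive (0 : R) 1 (fun t => a * t ^+ 2 + b * t) b.
Proof.
have did := is_derive_id (0 : R) 1.
have := is_derive_comb a b (is_deriveX 2 did) did.
by rewrite expr1 mulr0 scale0r mulr0 add0r mulr1.
Qed.

End first_order_conditions.

(** * Functions of space alone, viewed on the space-time cylinder *)

Section cylinder.
Context (R : realType) (d : nat) (Om : lipschitz_domain R d) (T : R).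
Hypothesis T_gt0 : 0 < T.
Local Notation cyl := (cyl_measure Om T).
Implicit Types z : 'rV[R]_d -> R.

Lemma measurable_domain : measurable (Om : set 'rV[R]_d).
Proof. exact: open_measurable_rV (@dom_open _ _ Om). Qed.

Definition cyl_ext z : measurableTypeR R * 'rV[R]_d -> R := fun tx => z tx.2.

Let mproj :
  measurable_fun setT (snd : measurableTypeR R * 'rV[R]_d -> 'rV[R]_d).
Proof. exact: measurable_snd. Qed.

Lemma cyl_pushforward (A : set 'rV[R]_d) : measurable A ->
  pushforward cyl snd A = (T%:E * lebesgue_rV R d (A `&` Om))%E.
Proof.
move=> mA; rewrite /pushforward /cyl_measure /= /mrestr.
rewrite (_ : snd @^-1` A `&` _ =
    (`]0, T[ : set (measurableTypeR R)) `*` (A `&` Om)).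
  rewrite product_measure1E//; last first.
    by apply: measurableI => //; exact: measurable_domain.
  by rewrite /= lebesgue_measure_itv/= lte_fin T_gt0 oppr0 adde0.
by apply/seteqP; split => [[t x]|[t x]] /=; tauto.
Qed.

(** The integrand sees only the spatial projection, and the image of the cylinder measure under it
    is T times Lebesgue measure on the domain. *)
Lemma cyl_ext_integral (h : 'rV[R]_d -> R) : measurable_fun setT h ->
  (forall x, 0 <= h x) ->
  (\int[cyl]_tx (h tx.2)%:E =
   T%:E * \int[lebesgue_rV R d]_(x in Om) (h x)%:E)%E.
Proof.
move=> mh h0; have mOm := measurable_domain.
have mhE D : measurable_fun D (EFin \o h).
  by apply/measurable_EFinP; exact: measurable_funS mh.
have := @ge0_integral_pushforward _ _ _ _ R snd mproj cyl setT (EFin \o h)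
  measurableT (mhE _) (fun x _ => h0 x).
rewrite preimage_setT => <-.
pose k : {nonneg R} := NngNum (ltW T_gt0).
pose m := mscale k (mrestr (lebesgue_rV R d) mOm).
rewrite (@eq_measure_integral _ _ _ _ m); last first.
  by move=> A mA _; exact: cyl_pushforward.
have h0' x : setT x -> (0 <= (EFin \o h) x)%E by rewrite lee_fin.
rewrite ge0_integral_mscale//; congr (_ * _)%E.
(* The restricted measure gives no mass to the complement of [Om], and agrees with Lebesgue measure
   on subsets of [Om]. *)
rewrite (@ge0_negligible_integral _ _ _ _ _ (~` Om))//; last 2 first.
- exact: measurableC.
- by rewrite /= /mrestr setICl measure0.
rewrite setTD setCK; apply: eq_measure_integral => A mA AOm.
by rewrite /= /mrestr setIidl.
Qed.

Lemma cyl_ext_sq_integrable z :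
  L2_on Om z -> sq_integrable cyl setT (cyl_ext z).
Proof.
move=> [mz z2]; split; first exact: measurableT_comp.
rewrite (@cyl_ext_integral (fun x => z x ^+ 2)).
- by rewrite lte_mul_pinfty ?lee_fin ?(ltW T_gt0).
- exact: measurable_funX.
- by move=> x; exact: sqr_ge0.
Qed.

Lemma cyl_ext_dot z : L2_on Om z ->
  dotL2 cyl setT (cyl_ext z) (cyl_ext z) = T * L2_dot Om z z.
Proof.
move=> z2; apply: EFin_inj; rewrite dotL2_EFin//;
  try exact: cyl_ext_sq_integrable.
rewrite EFinM (dotL2_EFin (mu := lebesgue_rV R d) (D := Om)); last 3 first.
- exact: measurable_domain.
- exact: L2_on_sq_integrable.
- exact: L2_on_sq_integrable.
rewrite (@cyl_ext_integral (fun x => z x * z x))//.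
- by apply: measurable_funM; case: z2.
- by move=> x; rewrite -expr2 sqr_ge0.
Qed.

End cylinder.

Lemma norm_max0_le (R : realDomainType) (a : R) : `|Num.max a 0| <= `|a|.
Proof. by have [_|_] := leP a 0; rewrite ?normr0. Qed.

(** * Multipliers at a local solution *)

Section optimality.
Context (R : realType) (d : nat) (d_gt0 : (0 < d)%N).
Context (Om : lipschitz_domain R d).
Context (T : R) (T_gt0 : 0 < T) (s : R) (s_ge0 : 0 <= s).
Context (W : fractional_space Om).
Context (f : Uspace Om T -> R) (alpha beta gamma p : R).
Context (ubar : Uspace Om T) (wbar : 'rV[R]_d -> R).
Hypothesis df : differentiable f ubar.
Hypothesis sol : local_solution s W f alpha beta gamma p ubar wbar.
Local Notation U := (Uspace Om T).
Local Notation cyl := (cyl_measure Om T).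
Local Notation dot := (dotL2 cyl setT).
Local Notation Z := (measurableTypeR R * 'rV[R]_d)%type.
Local Notation ext := (@cyl_ext R d).

Let mOm := measurable_domain Om.
Let bOm := @dom_bounded _ _ Om.

Let wbarW : inW s W wbar. Proof. by have [[]] := sol. Qed.

Let adm : {ae cyl, forall z, `|ubar z| <= wbar z.2}.
Proof. by have [[]] := sol. Qed.

Let wbar2 : L2_on Om wbar. Proof. exact: inW_L2_on wbarW. Qed.

(** Keeps competitors within the radius of local optimality; [c + 1] allows for [c = 0]. *)
Let radius (c rho t : R) :
  0 <= c -> t < rho / (c + 1) -> 0 <= t -> t * c <= rho.
Proof.
move=> c0; rewrite ltr_pdivlMr ?ltr_wpDl// => /ltW h t0; apply: le_trans h.
by rewrite mulrDr lerDl mulr1.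
Qed.

(** With [wbar] kept, the W-norm and the sparsity term cancel from the comparison; what remains is
    differentiable in [t], with the derivative stated. *)
Lemma variational_inequality (h : U) :
  (forall t, 0 < t < 1 -> admissible s W (t *: h + ubar) wbar) ->
  0 <= 'd f ubar h + alpha * dot ubar h.
Proof.
move=> hadm; have [_ [rho rho0 opt]] := sol.
pose delta := Num.min 1 (rho / (`|h| + 1)).
have delta0 : 0 < delta by rewrite lt_min ltr01 divr_gt0// ltr_wpDl.
pose A := alpha / 2 * `|h| ^+ 2; pose B := alpha * dot ubar h.
have dF := is_derive_comb 1 1 (is_derive_along h df) (is_derive_quadratic A B).
rewrite !mul1r in dF; apply: (one_sided_min_derive_ge0 dF delta0).
move=> t /andP[t0]; rewrite lt_min => /andP[t1 trho].
have tadm : admissible s W (t *: h + ubar) wbar by apply: hadm; rewrite t0.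
have near_u : `|t *: h + ubar - ubar| <= rho.
  by rewrite addrK normrZ (gtr0_norm t0) radius// ltW.
have near_w : W_norm s W (wbar - wbar) <= rho.
  have -> : wbar - wbar = 0 *: wbar by rewrite subrr scale0r.
  by rewrite W_normZ// normr0 mul0r ltW.
have := opt _ _ tadm near_u near_w.
rewrite /Phi0 Lspace2_sqr_normD scale0r add0r expr0n /= mulr0n (dotL2C _ _ h)
  /A /B.
lra.
Qed.

Lemma scaling_identity :
  'd f ubar ubar + alpha * dot ubar ubar + beta * W_dot s W wbar wbar +
  gamma * (p * \int[lebesgue_rV R d]_(x in Om) (`|wbar x| `^ p)) = 0.
Proof.
have [_ [rho rho0 opt]] := sol.
set P := Rintegral _ _ _.
(* A common bound for both displacements, [t *: ubar] and [t *: wbar]. *)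
pose c := `|ubar| + W_norm s W wbar.
have c0 : 0 <= c by rewrite addr_ge0// sqrtr_ge0.
pose delta := Num.min 1 (rho / (c + 1)).
have delta0 : 0 < delta by rewrite lt_min ltr01 divr_gt0// ltr_wpDl.
pose A := alpha / 2 * `|ubar| ^+ 2 + beta / 2 * W_dot s W wbar wbar.
have dF := is_derive_comb 1 1 (is_derive_along ubar df)
  (is_derive_comb A (gamma * P) (is_derive_sqr 1) (is_derive_power p)).
have := local_min_derive_eq0 dF delta0.
rewrite !mul1r => h; rewrite -[RHS]h.
  by rewrite /A Lspace2_sqr_norm; field.
move=> t; rewrite lt_min => /andP[t1 trho].
(* Nonnegativity of [t + 1] preserves the constraint and removes the absolute value from the factor
   of the sparsity term. *)
have t1' : 0 <= t + 1 by move: t1; rewrite ltr_norml => /andP[? _]; lra.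
have tw : (t + 1) *: wbar - wbar = t *: wbar by rewrite scalerDl scale1r addrK.
have tadm : admissible s W (t *: ubar + ubar) ((t + 1) *: wbar).
  split; first exact: inWZ.
  have := Lspace2_linE t ubar ubar; apply: filterS2 adm => z uw /(_ I) ->.
  rewrite !fctE /GRing.scale/= -{2}[ubar z]mul1r -mulrDl normrM ger0_norm//.
  by rewrite ler_wpM2l.
have near_u : `|t *: ubar + ubar - ubar| <= rho.
  rewrite addrK normrZ; apply: le_trans (radius c0 trho (normr_ge0 _)).
  by rewrite ler_wpM2l// lerDl sqrtr_ge0.
have near_w : W_norm s W ((t + 1) *: wbar - wbar) <= rho.
  rewrite tw W_normZ//; apply: le_trans (radius c0 trho (normr_ge0 _)).
  by rewrite ler_wpM2l// lerDr.
have := opt _ _ tadm near_u near_w.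
have -> : t *: ubar + ubar = (t + 1) *: ubar by rewrite scalerDl scale1r.
have Pt : \int[lebesgue_rV R d]_(x in Om) (`|((t + 1) *: wbar) x| `^ p) =
    (t + 1) `^ p * P.
  rewrite -ge0_RintegralZl ?powR_ge0//.
  - apply: eq_Rintegral => x _.
    by rewrite fctE /GRing.scale/= normrM (ger0_norm t1') powRM.
  - apply: (measurableT_comp (measurable_powR _)).
    apply: measurableT_comp => //.
    exact: measurable_funS wbar2.1.
rewrite /Phi0 Pt W_normZ// !exprMn W_norm_sqr//
  normrZ exprMn real_normK ?num_real//.
rewrite scale0r !add0r powR1 -/P /A; lra.
Qed.

Variable g : U.
Hypothesis gE : forall v : U, dot g v = 'd f ubar v + alpha * dot ubar v.

Let ext2 z : L2_on Om z -> sq_integrable cyl setT (ext z).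
Proof. exact: cyl_ext_sq_integrable. Qed.

Let mg : measurable_fun setT (g : Z -> R). Proof. exact: Lspace_measurable. Qed.

(* On the set where wbar vanishes the multipliers are not unique; the parts of g
   are the choice with the smallest modulus. *)
Lemma multiplier_exists : exists mu1 mu2 : U,
  ae_eq cyl setT mu1 (fun z => - Num.max (- g z) 0) /\
  ae_eq cyl setT mu2 (fun z => - Num.max (g z) 0).
Proof.
have g2 : sq_integrable cyl setT (g : Z -> R) by exact: Lspace2_sq_integrable.
have [mu1 mu1E] : exists mu1 : U,
    ae_eq cyl setT mu1 (fun z => - Num.max (- g z) 0).
  apply: sq_integrable_Lspace2; apply: sq_integrable_le g2 => //.
    by apply: measurableT_comp => //; apply: measurable_maxr => //;
      exact: measurableT_comp.
  by move=> z _; rewrite normrN; apply: le_trans (norm_max0_le _) _;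
    rewrite normrN.
have [mu2 mu2E] : exists mu2 : U,
    ae_eq cyl setT mu2 (fun z => - Num.max (g z) 0).
  apply: sq_integrable_Lspace2; apply: sq_integrable_le g2 => //.
    by apply: measurableT_comp => //; exact: measurable_maxr.
  by move=> z _; rewrite normrN; exact: norm_max0_le.
by exists mu1, mu2.
Qed.

Variables mu1 mu2 : U.
Hypothesis mu1E : ae_eq cyl setT mu1 (fun z => - Num.max (- g z) 0).
Hypothesis mu2E : ae_eq cyl setT mu2 (fun z => - Num.max (g z) 0).

Let uS (u : U) : sq_integrable cyl setT (u : Z -> R).
Proof. exact: Lspace2_sq_integrable. Qed.

Lemma multiplier_sub v : sq_integrable cyl setT v ->
  dot g v = dot mu1 v - dot mu2 v.
Proof.
move=> v2; rewrite ![dot _ v]dotL2C -dotL2Br//.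
have [mv _] := v2.
have [mB _] := sq_integrableB measurableT (uS mu1) (uS mu2).
apply: eq_dotL2_ae => //.
apply: filterS2 mu1E mu2E => z /(_ I) h1 /(_ I) h2; rewrite !fctE h1 h2;
  congr (_ * _).
by case: (leP (- g z) 0); case: (leP (g z) 0); lra.
Qed.

Lemma multiplier_le0 :
  {ae cyl, forall z, mu1 z <= 0} /\ {ae cyl, forall z, mu2 z <= 0}.
Proof.
split.
  by apply: filterS mu1E => z /(_ I) ->; rewrite oppr_le0 le_max lexx orbT.
by apply: filterS mu2E => z /(_ I) ->; rewrite oppr_le0 le_max lexx orbT.
Qed.

Let extw : sq_integrable cyl setT (ext wbar). Proof. exact: ext2. Qed.

(* The competitor is -wbar where g > 0 and wbar elsewhere. *)
Lemma complementarity :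
  dot mu1 (ext wbar - (ubar : Z -> R)) = 0 /\
  dot mu2 (ext wbar + (ubar : Z -> R)) = 0.
Proof.
have [mu1_le0 mu2_le0] := multiplier_le0.
have le1 : dot mu1 (ext wbar - (ubar : Z -> R)) <= 0.
  apply: dotL2_le0_ae => //; first exact: sq_integrableB.
  apply: filterS2 mu1_le0 adm => z m1 uw; rewrite fctE mulr_le0_ge0//.
  by rewrite subr_ge0; apply: le_trans uw; exact: ler_norm.
have le2 : dot mu2 (ext wbar + (ubar : Z -> R)) <= 0.
  apply: dotL2_le0_ae => //; first exact: sq_integrableD.
  apply: filterS2 mu2_le0 adm => z m2 uw; rewrite fctE mulr_le0_ge0//.
  by move: uw; rewrite ler_norml -subr_ge0 opprK addrC => /andP[].
pose G := [set z | 0 < g z].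
have mG : measurable G.
  have := mg measurableT (measurable_itv `]0, +oo[); rewrite setTI.
  by congr measurable; apply/seteqP; split=> z /=; rewrite in_itv/= andbT.
pose v0 z := ext wbar z * (1 - 2 * \1_G z).
have mv0 : measurable_fun setT v0.
  apply: measurable_funM; first by case: extw.
  by apply: measurable_funB => //; apply: measurable_funM.
have v0_norm z : `|v0 z| = `|ext wbar z|.
  rewrite normrM indicE; case: (_ \in _);
    rewrite /= ?mulr1 ?mulr0 ?subr0 ?normr1 ?mulr1//.
  by rewrite (_ : 1 - 2 = -1) ?normrN ?normr1 ?mulr1//; ring.
have v02 : sq_integrable cyl setT v0.
  by apply: sq_integrable_le extw => // z _; rewrite v0_norm.
have [v vE] := sq_integrable_Lspace2 v02.
(* Almost everywhere [g v = - |g| wbar], and [mu1 + mu2 = - |g|]. *)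
have gv : dot g v = dot mu1 (ext wbar) + dot mu2 (ext wbar).
  rewrite ![dot _ (ext _)]dotL2C -dotL2Dr//.
  have [mD _] := sq_integrableD measurableT (uS mu1) (uS mu2).
  apply: eq_dotL2_ae => //; [by case: (uS v)|by case: extw|].
  apply: filterS3 vE mu1E mu2E => z /(_ I) -> /(_ I) h1 /(_ I) h2.
  rewrite !fctE h1 h2 /v0 indicE.
  case: (boolP (z \in G)) => [/set_mem|/negP zG].
    rewrite /G/= => /ltW g0; have gN : - g z <= 0 by rewrite oppr_le0.
    by rewrite (max_r gN) (max_l g0); ring.
  have g0 : g z <= 0 by rewrite leNgt; apply/negP => h; apply: zG; rewrite inE.
  have gN : 0 <= - g z by rewrite oppr_ge0.
  by rewrite (max_l gN) (max_r g0) /=; ring.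
(* The competitor is [t v + (1 - t) ubar], a convex combination of two functions bounded in modulus
   by [wbar]. *)
have hadm t : 0 < t < 1 -> admissible s W (t *: ((-1) *: ubar + v) + ubar) wbar.
  move=> /andP[t0 t1]; split => //.
  have e1 := Lspace2_linE t ((-1) *: ubar + v) ubar.
  have e2 := Lspace2_linE (-1) ubar v.
  near=> z.
  have -> : (t *: ((-1) *: ubar + v) + ubar) z = t * v z + (1 - t) * ubar z.
    transitivity (t * (((-1) *: ubar + v : U) : Z -> R) z + ubar z).
      exact: (near e1 z).
    have -> : (((-1) *: ubar + v : U) : Z -> R) z = -1 * ubar z + v z.
      exact: (near e2 z).
    ring.
  have uw : `|ubar z| <= wbar z.2 by near: z.
  have vw : `|v z| = `|wbar z.2|.
    by rewrite (near vE z)// v0_norm.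
  have w0 : 0 <= wbar z.2 by exact: le_trans (normr_ge0 _) uw.
  apply: le_trans (ler_normD _ _) _; rewrite !normrM vw (ger0_norm w0).
  rewrite (gtr0_norm t0) ger0_norm ?subr_ge0 ?(ltW t1)//.
  have : (1 - t) * `|ubar z| <= (1 - t) * wbar z.2.
    by rewrite ler_wpM2l// subr_ge0 ltW.
  by lra.
have := variational_inequality hadm.
rewrite -gE Lspace2_dot_linr gv mulN1r multiplier_sub// => sum_ge0.
(* The derivative along [v - ubar] is the sum of two products already known to be nonpositive. *)
have : dot mu1 (ext wbar - (ubar : Z -> R)) +
    dot mu2 (ext wbar + (ubar : Z -> R)) =
    - (dot mu1 ubar - dot mu2 ubar) + (dot mu1 (ext wbar) + dot mu2 (ext wbar)).
  by rewrite dotL2Br// dotL2Dr//; ring.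
move=> sumE; rewrite -sumE in sum_ge0.
by split; apply/eqP; rewrite eq_le; apply/andP; split => //; lra.
Unshelve. all: by end_near. Qed.

(** Complementarity reduces [(mu, v - vbar)] to [(mu, v)], a product of a nonpositive and a
    nonnegative function. *)
Lemma multiplier_subdiff :
  subdiff_IC (fun tx => wbar tx.2 - ubar tx) mu1 /\
  subdiff_IC (fun tx => wbar tx.2 + ubar tx) mu2.
Proof.
have [mu1_le0 mu2_le0] := multiplier_le0; have [c1 c2] := complementarity.
have sub (mu v : U) (vbar : Z -> R) : {ae cyl, forall z, mu z <= 0} ->
    sq_integrable cyl setT vbar -> dot mu vbar = 0 -> nonneg Om T v ->
    U_dot Om T mu (fun z => v z - vbar z) <= 0.
  move=> mu0 vbar2 vbar0 v0.
  have -> : U_dot Om T mu (fun z => v z - vbar z) =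
      dot mu ((v : Z -> R) - vbar).
    by [].
  rewrite dotL2Br// vbar0 subr0; apply: dotL2_le0_ae => //.
  by apply: filterS2 mu0 v0 => z m0 v0; rewrite mulr_le0_ge0.
split; split.
- apply: filterS adm => z uw; rewrite subr_ge0; apply: le_trans uw.
  exact: ler_norm.
- by move=> v v0; apply: sub => //; exact: sq_integrableB.
- apply: filterS adm => z; rewrite ler_norml -subr_ge0 opprK addrC.
  by move=> /andP[].
- by move=> v v0; apply: sub => //; exact: sq_integrableD.
Qed.

Hypothesis gamma_gt0 : 0 < gamma.

Definition multiplier_lambda z : R :=
  - gamma^-1 * (beta * W_dot s W wbar z + (dot mu1 (ext z) + dot mu2 (ext z))).

(** Cauchy-Schwarz in W handles the first term. For the products with [mu1] and [mu2] it is used in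
    [U]: [T] comes from extending [z] constantly in time, [C] from the embedding of W in L^2. *)
Lemma multiplier_lambda_dual : W_dual s W multiplier_lambda.
Proof.
split.
  move=> a u w uW wW; have u2 := ext2 (inW_L2_on mOm uW).
  have w2 := ext2 (inW_L2_on mOm wW).
  rewrite /multiplier_lambda (W_dot_linr mOm s_ge0)//.
  have -> : ext (a *: u + w) = a *: ext u + ext w by [].
  rewrite !dotL2_linr//; ring.
have [C C0 L2W] := L2_dot_le_W_dot mOm bOm d_gt0 s_ge0 W.
pose K := Num.sqrt (dot mu1 mu1) + Num.sqrt (dot mu2 mu2).
exists (gamma^-1 * (`|beta| * W_norm s W wbar + K * Num.sqrt (T * C))) => z zW.
have z2 := inW_L2_on mOm zW.
have ez : Num.sqrt (dot (ext z) (ext z)) <= Num.sqrt (T * C) * W_norm s W z.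
  rewrite cyl_ext_dot// -sqrtrM ?mulr_ge0 ?(ltW T_gt0)//; apply: ler_wsqrtr.
  by rewrite -mulrA ler_pM2l//; exact: L2W.
have dotz (mu : U) : `|dot mu (ext z)| <=
    Num.sqrt (dot mu mu) * (Num.sqrt (T * C) * W_norm s W z).
  apply: le_trans (dotL2_cauchy_schwarz measurableT (uS mu) (ext2 z2)) _.
  by rewrite ler_wpM2l ?sqrtr_ge0.
have gV0 : 0 < gamma^-1 by rewrite invr_gt0.
rewrite /multiplier_lambda normrM normrN (gtr0_norm gV0) -mulrA ler_pM2l//.
rewrite mulrDl; apply: le_trans (ler_normD _ _) _; apply: lerD.
  rewrite normrM -mulrA ler_wpM2l//.
  exact: (W_dot_cauchy_schwarz mOm s_ge0).
apply: le_trans (ler_normD _ _) _; rewrite /K -mulrA mulrDl.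
by apply: lerD; exact: dotz.
Qed.

(** The terms in [v] cancel because [mu1 - mu2] represents the derivative in [U], those in [z] by
    the choice of [multiplier_lambda]. *)
Lemma stationarity (v : U) z : inW s W z ->
  'd f ubar v + alpha * U_dot Om T ubar v + beta * W_dot s W wbar z +
  gamma * multiplier_lambda z + U_dot Om T mu1 (fun tx => z tx.2 - v tx) +
  U_dot Om T mu2 (fun tx => z tx.2 + v tx) = 0.
Proof.
move=> /(inW_L2_on mOm) /ext2 z2.
have -> : U_dot Om T mu1 (fun tx => z tx.2 - v tx) =
    dot mu1 (ext z - (v : Z -> R)).
  by [].
have -> : U_dot Om T mu2 (fun tx => z tx.2 + v tx) =
    dot mu2 (ext z + (v : Z -> R)).
  by [].
rewrite -[U_dot Om T ubar v]/(dot ubar v) -gE multiplier_sub// dotL2Br//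
  dotL2Dr//.
by rewrite /multiplier_lambda; field; rewrite gt_eqF.
Qed.

(** Complementarity turns [(mu1 + mu2, wbar)] into [(mu1 - mu2, ubar)], that is [(g, ubar)], which
    the scaling identity evaluates; the W-norm terms then cancel. *)
Lemma multiplier_lambda_wbar : multiplier_lambda wbar =
  p * \int[lebesgue_rV R d]_(x in Om) (`|wbar x| `^ p).
Proof.
have [c1 c2] := complementarity; have := scaling_identity.
rewrite dotL2Br// in c1; rewrite dotL2Dr// in c2.
rewrite -gE multiplier_sub// /multiplier_lambda; set P := p * _ => h.
have -> : dot mu1 (ext wbar) + dot mu2 (ext wbar) = dot mu1 ubar - dot mu2 ubar.
  by lra.
have -> : dot mu1 ubar - dot mu2 ubar =
    - beta * W_dot s W wbar wbar - gamma * P.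
  by lra.
by field; rewrite gt_eqF.
Qed.

End optimality.

Theorem theorem4p9 (R : realType) (d : nat) (d_gt0 : (0 < d)%N)
    (Om : lipschitz_domain R d) (T : R) (T_gt0 : 0 < T)
    (s : R) (s01 : 0 < s < 1) (W : fractional_space Om)
    (f : Uspace Om T -> R)
    (f_wlsc : weakly_lsc f) (f_bounded : affinely_minorized f)
    (f_C1 : continuously_differentiable f)
    (alpha beta gamma p : R) (alpha_gt0 : 0 < alpha) (beta_gt0 : 0 < beta)
    (gamma_gt0 : 0 < gamma) (p01 : 0 < p < 1)
    (ubar : Uspace Om T) (wbar : 'rV[R]_d -> R)
    (ubar_wbar : local_solution s W f alpha beta gamma p ubar wbar) :
  exists (lambda : ('rV[R]_d -> R) -> R) (mu1 mu2 : Uspace Om T),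
    [/\ W_dual s W lambda,
        (forall (v : Uspace Om T) (z : 'rV[R]_d -> R), inW s W z ->
          'd f ubar v + alpha * U_dot Om T ubar v + beta * W_dot s W wbar z +
          gamma * lambda z +
          U_dot Om T mu1 (fun tx => z tx.2 - v tx) +
          U_dot Om T mu2 (fun tx => z tx.2 + v tx) = 0),
        lambda wbar = p * \int[lebesgue_rV R d]_(x in Om) (`|wbar x| `^ p),
        subdiff_IC (fun tx => wbar tx.2 - ubar tx) mu1 &
        subdiff_IC (fun tx => wbar tx.2 + ubar tx) mu2].
Proof.
have s_ge0 : 0 <= s by case/andP: s01 => /ltW.
have df := f_C1.1 ubar.
have [g0 g0E] := riesz_Lspace2 (diff_continuous df).
pose g : Uspace Om T := alpha *: ubar + g0.
have gE (v : Uspace Om T) : dotL2 (cyl_measure Om T) setT g v =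
    'd f ubar v + alpha * dotL2 (cyl_measure Om T) setT ubar v.
  rewrite dotL2C Lspace2_dot_linr (dotL2C _ _ v g0) -g0E (dotL2C _ _ v).
  exact: addrC.
have [mu1 [mu2 [mu1E mu2E]]] := multiplier_exists g.
have [sub1 sub2] :=
  multiplier_subdiff T_gt0 s_ge0 df ubar_wbar gE mu1E mu2E.
exists (multiplier_lambda s W beta gamma wbar mu1 mu2), mu1, mu2; split => //.
- exact: (multiplier_lambda_dual d_gt0 T_gt0 s_ge0 ubar_wbar).
- by move=> v z zW; exact: (stationarity T_gt0 _ _ gE mu1E mu2E).
- exact: (multiplier_lambda_wbar T_gt0 s_ge0 df ubar_wbar gE mu1E mu2E).
Qed.
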